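(* Let $G$ be an oriented graph on a surface, let $G^*$ be its dual graph, and let $k$ be a positive integer. Then the following hold. (Dualities) $$\tau(G;k)=\phi^{bal}(G^*;k),\qquad \tau^{loc}(G;k)=\phi(G^*;k),$$ $$|AO(G)|=|TBO(G^* )|,\qquad |BAO(G)|=|TCO(G^* )|.$$ (Evaluations at $-1$) $$|\tau(G;-1)|=|AO(G)|,\qquad |\tau^{loc}(G;-1)|=|BAO(G)|,$$ $$|\phi(G^*;-1)|=|TCO(G^* )|,\qquad |\phi^{bal}(G^*;-1)|=|TBO(G^* )|.$$ (Reciprocities) $$|\tau(G;-k)|=|\{(t,\mathfrak{o}): t\in T(G;k),\ \mathfrak{o}\in AO(G\setminus \operatorname{supp}(t))\}|,$$ $$|\tau^{loc}(G;-k)|=|\{(t,\mathfrak{o}): t\in T^{loc}(G;k),\ \mathfrak{o}\in BAO(G\mathbin{\backslash\!\backslash} \operatorname{supp}(t))\}|,$$ $$|\phi(G;-k)|=|\{(f,\mathfrak{o}): f\in \Phi(G;k),\ \mathfrak{o}\in TCO(G\mathbin{/\!/} \operatorname{supp}(f))\}|,$$ $$|\phi^{bal}(G;-k)|=|\{(f,\mathfrak{o}): f\in \Phi^{bal}(G;k),\ \mathfrak{o}\in TBO(G/ \operatorname{supp}(f))\}|.$$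
   Context: Graphs on surfaces: graphs may have loops and multiple edges. A graph on a surface $G=(V,E,F)$ is a graph $(V,E)$ cellularly embedded in a closed oriented (not necessarily connected) surface $\Sigma$, i.e. $\Sigma\setminus G$ is a disjoint union of discs, the faces, forming the set $F$. Equivalently $G$ is an orientable ribbon graph: a surface with boundary that is a union of vertex discs and edge discs (each edge disc meeting the vertex discs in exactly two disjoint segments); capping each boundary component by a disc (a face) gives $\Sigma$. The dual $G^*$ is the graph on $\Sigma$ with one vertex per face of $G$, one face per vertex of $G$, and for each edge $e$ of $G$ a dual edge $e^*$ crossing $e$ and joining the (possibly equal) faces on its two sides. An oriented graph on a surface has a fixed reference orientation $\sigma$ of its edges (the counts below do not depend on it). Deletion and contraction (ribbon graphs): $G\setminus A$ deletes the edge discs in $A$. $G/A$ contracts the edges in $A$ one after another (in any order): a non-loop $e$ with ends $v,w$ is contracted by replacing $e,v,w$ by the single vertex disc $e\cup v\cup w$; for a loop $e$ at $v$, $e\cup v$ is an annulus, and $e$ and $v$ are replaced by two new vertex discs bounded by the two boundary circles of $e\cup v$. $G\mathbin{/\!/}A$ is the usual contraction of abstract graphs: contract the edges of $A$ successively, a loop being simply deleted. $G\mathbin{\backslash\!\backslash}A$: process the edges of $A$ successively, deleting an edge if it is not a coloop of the current graph on a surface and contracting it (as a ribbon graph) if it is a coloop, where a coloop is an edge having the same face on both sides. Boundaries: for $F'\subseteq F$, $\partial F'$ is the set of edges having two distinct adjacent faces exactly one of which is in $F'$; each such edge has a natural direction, the one induced by the orientation of its adjacent face in $F'$ as a submanifold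 of $\Sigma$ (giving $\overrightarrow{\partial F'}$). For an orientation $\mathfrak{o}$, $\overrightarrow{\partial_{\mathfrak{o}}F'}\in\{0,\pm1\}^E$ has entry $0$ at $e\notin\partial F'$, and $1$ (resp. $-1$) at $e\in\partial F'$ if $\overrightarrow{\partial F'}$ and $\mathfrak{o}$ agree (resp. disagree) on $e$. A nonempty boundary is coherently oriented if the nonzero entries are all $+1$ or all $-1$. Cocycles: a cocycle is a sequence $(f_0,e_1,f_1,\dots,e_k,f_k=f_0)$ of non-repeating edges and faces with consecutive ones adjacent (equivalently, the dual of a cycle of $G^*$), identified with its edge set. It forms an annulus bounded by two circles whose core is the dual cycle, and each edge of the cocycle crosses the annulus from one boundary circle to the other. A pair $(e_1,e_2)$ of edges of a cocycle $C$ is coherently oriented with respect to $C$ if both are directed from the same boundary circle to the other. Orientations: $AO$ = acyclic orientations (no directed cycle; loops count as cycles). $TCO$ = totally cyclic orientations (every edge lies in a directed cycle). $BAO$ = boundary acyclic orientations (no coherently oriented nonempty boundary). $TBO$ = totally bi-walkable orientations: for every edge $e$ there is a bidirectional closed walk containing $e$, where a closed walk (vertices and edges may repeat) traversing every edge along its direction is bidirectional if, for every cocycle $C$ sharing an edge with $W$, there is a pair $(e_1,e_2)$ of edges in $C\cap W$ that is not coherently oriented with respect to $C$. Each of $AO(G)$, $TCO(G)$, $BAO(G)$, $TBO(G)$ denotes the set of such orientations of $G$. Tensions and flows ($\mathbb{Z}_k=\mathbb{Z}/k\mathbb{Z}$): - $T(G;k)$: $\mathbb{Z}_k$-tensions,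 maps $x:E\to\mathbb{Z}_k$ such that for each directed cycle $\mathcal{C}$, $\sum_{e\in\mathcal{C}}s(e)x(e)=0$, with $s(e)=1$ if the directions of $e$ in $\mathcal{C}$ and $\sigma$ agree and $-1$ otherwise (here a directed cycle is a cycle of the underlying graph with a chosen direction of traversal). - $T^{loc}(G;k)$: local $\mathbb{Z}_k$-tensions, maps $t:E\to\mathbb{Z}_k$ with $\sum_{e\in\partial f}\overrightarrow{\partial_\sigma f}(e)t(e)=0$ for every face $f$ (where $\partial f=\partial\{f\}$). - $\Phi(G;k)$: $\mathbb{Z}_k$-flows, maps $x:E\to\mathbb{Z}_k$ such that at each vertex the sum of $x$ over edges with head $v$ equals the sum over edges with tail $v$. - $\Phi^{bal}(G;k)$: balanced $\mathbb{Z}_k$-flows, i.e. $\mathbb{Z}_k$-flows such that for each cocycle $C$ the values on the edges of $C$ sum to zero, where the value of an edge is counted with sign $+$ if $\sigma$ directs it from a chosen boundary circle of the annulus of $C$ to the other, and with sign $-$ otherwise. For positive integers $k$, $\tau(G;k),\tau^{loc}(G;k),\phi(G;k),\phi^{bal}(G;k)$ denote the numbers of nowhere-zero elements of $T(G;k),T^{loc}(G;k),\Phi(G;k),\Phi^{bal}(G;k)$ respectively. Each is a polynomial in $k$, and the values at negative integers are those of the polynomial. $\operatorname{supp}(x)=\{e:x(e)\neq0\}$. *)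

(* Defs.v *)
From HB Require Import structures.
From mathcomp Require Import all_boot all_order all_fingroup all_algebra.
From mathcomp Require Import boolp.

Set Implicit Arguments.
Unset Strict Implicit.
Unset Printing Implicit Defensive.

Import GRing.Theory.

(* Oriented graphs on surfaces are encoded as rotation systems.  The edge [e] *)
(* has the half-edges [(e, true)], at its tail, and [(e, false)], at its      *)
(* head, for the reference orientation; the dart [d] also stands for the edge *)
(* [d.1] directed away from the half-edge [d].                                *)
Notation dart E := (E * bool)%type (only parsing).

Definition drev (E : finType) (d : dart E) : dart E := (d.1, ~~ d.2).

(* [rot] is the counterclockwise rotation around the vertices.  The edges of  *)
(* the graph form a subset [edges] of [E]; a dart whose edge is not in        *)
(* [edges] is just a marked point on the boundary of a vertex disc.  Marked   *)
(* points carry no information, except that an isolated vertex is an orbit of *)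
(* [rot] consisting of marked points only.  Deleting an edge turns its darts  *)
(* into marked points, so that no vertex is lost.  No axiom is needed: every  *)
(* such pair is an orientable ribbon graph (possibly with loops, multiple     *)
(* edges, isolated vertices, several components), and conversely.             *)
Record sgraph (E : finType) := SGraph {
  edges : {set E};
  rot : {perm dart E}
}.

Definition flip_fun (E : finType) (A : {set E}) (d : dart E) : dart E :=
  if d.1 \in A then drev d else d.

Lemma flip_funK (E : finType) (A : {set E}) : involutive (flip_fun A).
Proof.
by case=> e b; rewrite /flip_fun /drev; case eA: (e \in A); rewrite /= eA ?negbK.
Qed.

Definition flip (E : finType) (A : {set E}) : {perm dart E} :=
  perm (can_inj (flip_funK A)).

Section Graphs.
Variable E : finType.
Implicit Types (G : sgraph E) (A : {set E}) (e : E) (d : dart E).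
Implicit Types (c w : seq (dart E)) (o v f : {set dart E}).

Definition vertices G : {set {set dart E}} := porbits (rot G).

Definition vert G d : {set dart E} := porbit (rot G) d.

(* Products of permutations act from left to right: a boundary component is   *)
(* followed by running along [d] and then rotating at the head of [d].  This  *)
(* keeps the face on the right-hand side; hence, for an edge [d.1] of [G],    *)
(* [face G d] is the face on the right of [d], and [face G (drev d)] the face *)
(* on its left.                                                               *)
Definition face_perm G : {perm dart E} := (flip (edges G) * rot G)%g.

Definition faces G : {set {set dart E}} := porbits (face_perm G).

Definition face G d : {set dart E} := porbit (face_perm G) d.

(* The dart [d] of the dual graph crosses the dart [d] of [G] from right to   *)
(* left.  As [face_perm G] runs clockwise around the faces, the               *)
(* counterclockwise rotation of the dual is its inverse.                      *)
Definition dual G : sgraph E := SGraph (edges G) (face_perm G)^-1%g.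

Definition is_loop G e : bool := vert G (e, true) == vert G (e, false).

Definition is_coloop G e : bool := face G (e, true) == face G (e, false).

(* In the four operations below, the processed edges must be edges of [G].    *)

Definition delete1 G e : sgraph E := SGraph (edges G :\ e) (rot G).

(* The orbits of the new rotation that contain darts of [e] are the boundary  *)
(* circles of the union of [e] and its end vertex discs: there is one such    *)
(* circle if [e] is not a loop, and there are two if [e] is a loop.           *)
Definition contract1 G e : sgraph E :=
  SGraph (edges G :\ e) (flip [set e] * rot G)%g.

(* For a non-loop, [contract1] is the usual contraction of the underlying     *)
(* abstract graph; only this underlying graph matters here.                   *)
Definition abstract_contract1 G e : sgraph E :=
  if is_loop G e then delete1 G e else contract1 G e.

Definition codelete1 G e : sgraph E :=
  if is_coloop G e then contract1 G e else delete1 G e.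

(* G \ A *)
Definition delete G A : sgraph E := foldl delete1 G (enum A).

(* G / A *)
Definition contract G A : sgraph E := foldl contract1 G (enum A).

(* G // A *)
Definition abstract_contract G A : sgraph E :=
  foldl abstract_contract1 G (enum A).

(* G \\ A *)
Definition codelete G A : sgraph E := foldl codelete1 G (enum A).

(* The two faces adjacent to such an edge are automatically distinct.         *)
Definition boundary G (F' : {set {set dart E}}) : {set E} :=
  [set e in edges G | (face G (e, true) \in F') (+) (face G (e, false) \in F')].

(* For a boundary edge [d.1], this is 1 if the direction of [d] is the one    *)
(* induced by the adjacent face in [F'], which then lies on the left of [d],  *)
(* and -1 otherwise.                                                          *)
Definition boundary_sign G (F' : {set {set dart E}}) d : int :=
  if d.1 \notin boundary G F' then 0%R
  else if face G (drev d) \in F' then 1%R else (-1)%R.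

(* Cyclic sequences of edges of [G] traversed as darts, where [at_ d] is the  *)
(* place from which [d] starts and [at_ (drev d)] the place it leads to.       *)
Definition closed_walk G (at_ : dart E -> {set dart E}) w : bool :=
  [&& w != [::], all (fun d => d.1 \in edges G) w
    & path.cycle (fun d d' => at_ (drev d) == at_ d') w].

Definition simple_closed_walk G (at_ : dart E -> {set dart E}) c : bool :=
  [&& closed_walk G at_ c, uniq [seq at_ d | d <- c]
    & uniq [seq d.1 | d <- c]].

Definition directed_cycle G c : bool := simple_closed_walk G (vert G) c.

(* A cocycle passes through each of its darts [d] from the face on the right  *)
(* of [d] to the face on the left of [d].  So the darts of the sequence all   *)
(* cross the annulus of the cocycle from the same boundary circle (the one on *)
(* the left of its core) to the other one.                                    *)
Definition cocycle G c : bool := simple_closed_walk G (face G) c.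

(* For two darts whose edges belong to the cocycle [c]. *)
Definition coherent_pair c (d1 d2 : dart E) : bool :=
  (d1 \in c) == (d2 \in c).

(* An orientation is the set of the darts along which the edges are directed. *)
Definition orientation G o : bool :=
  [forall d, (d \in o) == (d.1 \in edges G) && (drev d \notin o)].

Definition AO G : {set {set dart E}} :=
  [set o | orientation G o &
    `[< ~ exists c, directed_cycle G c /\ {subset c <= o} >]].

Definition TCO G : {set {set dart E}} :=
  [set o | orientation G o &
    `[< forall e, e \in edges G -> exists c,
          [/\ directed_cycle G c, {subset c <= o} & e \in [seq d.1 | d <- c]] >]].

Definition coherent_boundary G o (F' : {set {set dart E}}) : Prop :=
  boundary G F' != set0 /\
  exists s : int, (s = 1%R \/ s = (-1)%R) /\
    forall d, d \in o -> d.1 \in boundary G F' -> boundary_sign G F' d = s.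

Definition BAO G : {set {set dart E}} :=
  [set o | orientation G o &
    `[< ~ exists F' : {set {set dart E}},
          F' \subset faces G /\ coherent_boundary G o F' >]].

Definition bidirectional G w : Prop :=
  forall c, cocycle G c ->
    (exists2 d, d \in w & d.1 \in [seq d'.1 | d' <- c]) ->
    exists d1 d2, [/\ d1 \in w, d2 \in w,
      d1.1 \in [seq d.1 | d <- c], d2.1 \in [seq d.1 | d <- c]
      & ~~ coherent_pair c d1 d2].

Definition TBO G : {set {set dart E}} :=
  [set o | orientation G o &
    `[< forall e, e \in edges G -> exists w,
          [/\ closed_walk G (vert G) w, {subset w <= o}, bidirectional G w
            & e \in [seq d.1 | d <- w]] >]].

Section Functions.
Variable M : finZmodType.
Implicit Type x : {ffun E -> M}.

Definition supp x : {set E} := [set e | x e != 0%R].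

(* Functions on the edges of [G] are extended by 0 to [E]. *)
Definition edge_fun G x : bool := supp x \subset edges G.

Definition nowhere_zero G x : bool := edges G \subset supp x.

Definition dart_value x d : M := if d.2 then x d.1 else (- x d.1)%R.

Definition tensions G : {set {ffun E -> M}} :=
  [set x | edge_fun G x &
    `[< forall c, directed_cycle G c ->
          (\sum_(d <- c) dart_value x d)%R = 0%R >]].

Definition local_tensions G : {set {ffun E -> M}} :=
  [set x | edge_fun G x &
    [forall f in faces G,
      (\sum_(e in boundary G [set f])
         x e *~ boundary_sign G [set f] (e, true))%R == 0%R]].

Definition flows G : {set {ffun E -> M}} :=
  [set x | edge_fun G x &
    [forall v in vertices G,
      (\sum_(e in edges G | vert G (e, false) == v) x e)%R ==
      (\sum_(e in edges G | vert G (e, true) == v) x e)%R]].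

Definition balanced_flows G : {set {ffun E -> M}} :=
  [set x in flows G |
    `[< forall c, cocycle G c ->
          (\sum_(d <- c) dart_value x d)%R = 0%R >]].

End Functions.

End Graphs.

(* Z/kZ for k > 0, including the trivial group for k = 1 (which 'Z_1 is not). *)
Notation Zmod k := ('I_k.-1.+1).

Section Counts.
Variables (E : finType) (G : sgraph E) (k : nat).

Definition tau : nat :=
  #|[set x in tensions (Zmod k) G | nowhere_zero G x]|.

Definition tau_loc : nat :=
  #|[set x in local_tensions (Zmod k) G | nowhere_zero G x]|.

Definition phi : nat :=
  #|[set x in flows (Zmod k) G | nowhere_zero G x]|.

Definition phi_bal : nat :=
  #|[set x in balanced_flows (Zmod k) G | nowhere_zero G x]|.

End Counts.

(* [f] is polynomial on the positive integers, and the (unique) polynomial    *)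
(* agreeing with [f] there takes a value of absolute value [n] at [z].        *)
Definition abs_value_at (f : nat -> nat) (z : int) (n : nat) : Prop :=
  exists p : {poly rat},
    (forall k : nat, 0 < k -> p.[k%:R]%R = (f k)%:R%R) /\
    (`|p.[z%:~R]|%R = n%:R%R).

(* Main.v *)
(* Inclusion-exclusion over the set [B] on which a function vanishes turns     *)
(* both kinds of counts into sums of terms (-1)^|B| k^a(B), because adding an  *)
(* edge to a subgraph multiplies the number of its flows (or divides the       *)
(* number of tensions vanishing on it) by [k] or by 1, according as the ends   *)
(* of the edge are joined by the subgraph or not.  At [-k], the power of [k]   *)
(* is read as a number of tensions (flows) again, so that the theorem reduces  *)
(* to the case k = 1.  There, for a subgroup [L] of Z^E (the integer flows, or *)
(* the integer cuts), the number of sign vectors for which no nonzero member   *)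
(* of [L] has conforming signs is computed by deletion and contraction.  An    *)
(* orientation is acyclic if it has no conforming flow and totally cyclic if   *)
(* it has no conforming cut.  On the surface, the tensions of [G] are the      *)
(* balanced flows of the dual, since coboundaries have zero divergence at the  *)
(* faces; similarly, an acyclic orientation is totally cyclic on the dual, and *)
(* a closed walk through a whole component of the dual is bidirectional.       *)

Require Import Defs.
From HB Require Import structures.
From mathcomp Require Import all_boot all_order all_fingroup all_algebra.
From mathcomp Require Import boolp zify.

Set Implicit Arguments.
Unset Strict Implicit.
Unset Printing Implicit Defensive.

Import Order.TTheory GRing.Theory Num.Theory.

(** * Sign vectors and deletion-contraction *)

(** The theorem rests on one reciprocity argument for graphs, used once for cycles and once for
    cuts, and on the exchange of a graph on a surface with its dual.

    Reciprocity: the functions that vanish on [B] number [k ^ a B], so inclusion-exclusion gives a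
    polynomial in [k]. At [-k] the term of [B] has the sign (-1)^(|B| + a B). By rank-nullity
    ([tension_flow_dim]) this is, up to a global sign, (-1)^(b B), where [b] is a dimension of the
    opposite kind: flows for tensions, tensions for flows. After the interchange of sums
    ([reciprocity]) each function contributes the sum of (-1)^(b B) over the subsets [B] of its zero
    set. By deletion-contraction ([card_pointed]) that sum is the number of sign vectors to which no
    nonzero integer flow (resp. cut) conforms. These are the acyclic orientations ([pointed_flowP])
    and, with Minty's alternative ([cycle_or_cut], [cycles_no_cut]), the totally cyclic ones
    ([pointed_cutP]). The evaluations at -1 are the case [k = 1].

    Duality: the graph lemmas are stated for an arbitrary map [at_] from darts to places, so they
    apply to vertices and to faces. Local tensions are flows of the dual ([local_tensionsE]), and
    coherent boundaries are directed cuts of the dual ([BAO_cut_free]). The balanced side needs that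
    a coboundary on one side is a flow on the other ([coboundary_flow]). So every tension of the
    dual is a balanced flow ([balanced_flows_dual]), and an orientation that is acyclic on the dual
    has no directed cut ([acyclic_dual_no_cut]), which produces the bidirectional walks
    ([TBO_dual]). Minors correspond as well: contraction to deletion ([dual_contract]), codeletion
    to abstract contraction ([BAO_codelete]). *)

Lemma set_ind (T : finType) (P : {set T} -> Prop) :
  P set0 -> (forall a (A : {set T}), a \notin A -> P A -> P (a |: A)) ->
  forall A, P A.
Proof.
move=> P0 PU A; have [n] := ubnP #|A|; elim: n A => // n IHn A ltAn.
have [->//|[a aA]] := set_0Vmem A.
rewrite -(setD1K aA); apply: PU; first by rewrite setD11.
by apply: IHn; rewrite (cardsD1 a) aA in ltAn.
Qed.

Lemma sum_subset_setU1 (R : nmodType) (T : finType) (a : T) (A : {set T})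
    (F : {set T} -> R) : a \notin A ->
  (\sum_(B : {set T} | B \subset a |: A) F B =
   \sum_(B : {set T} | B \subset A) F B +
   \sum_(B : {set T} | B \subset A) F (a |: B))%R.
Proof.
move=> aA; rewrite (bigID (fun B : {set T} => a \notin B)) /=; congr (_ + _)%R.
  apply: eq_bigl => B; apply/andP/idP => [[BaA aB]|BA]; last first.
    by rewrite (subset_trans BA (subsetUr _ _)) (contra (subsetP BA a)).
  by apply/subsetP=> x xB; have /setU1P[xa|//] := subsetP BaA x xB; rewrite xa (negPf aB) in xB *.
rewrite (reindex_onto (fun B => a |: B) (fun B => B :\ a)) /=; last first.
  by move=> B /andP[_]; rewrite negbK; apply: setD1K.
apply: eq_bigl => B; rewrite setU11 andbT.
apply/andP/idP => [[BaA /eqP <-]|BA].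
  by rewrite subDset.
by rewrite setUS // setU1K // (contra (subsetP BA a)).
Qed.

Lemma card_subset_setU1 (T : finType) (a : T) (A : {set T})
    (P : pred {set T}) : a \notin A ->
  #|[set B : {set T} | B \subset a |: A & P B]| =
  #|[set B : {set T} | B \subset A & P B]| +
  #|[set B : {set T} | B \subset A & P (a |: B)]|.
Proof.
by move=> aA; rewrite !cardsE -!sum1_card !big_mkcondr /= sum_subset_setU1.
Qed.

Lemma sum_sign_subsets (R : pzRingType) (T : finType) (A : {set T}) :
  (\sum_(B : {set T} | B \subset A) (-1) ^+ #|B| = (A == set0)%:R :> R)%R.
Proof.
elim/set_ind: A => [|a A aA _].
  by rewrite eqxx (big_pred1 set0) ?cards0 ?expr0 // => B; rewrite subset0.
rewrite sum_subset_setU1 // (_ : a |: A == set0 = false); last first.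
  by apply/set0Pn; exists a; rewrite setU11.
rewrite -big_split big1 //= => B BA.
by rewrite cardsU1 (contra (subsetP BA a) aA) exprS mulN1r subrr.
Qed.

Section SignVectors.

Local Open Scope ring_scope.

Variables (E : finType) (L : (E -> int) -> Prop).
Hypothesis L_comb : forall (a b : int) x y,
  L x -> L y -> L (fun e => a * x e + b * y e).

Implicit Types (S C B s : {set E}) (x : E -> int).

Definition conforms s S x :=
  forall e, e \in S -> if e \in s then 0 <= x e else x e <= 0.

(* The members of [L] supported in [S :|: C], restricted to [S], form the     *)
(* minor of [L] that is obtained by contracting [C] and deleting the rest.    *)
Definition pointed S C s := forall x, L x ->
  (forall e, e \notin S :|: C -> x e = 0) -> conforms s S x ->
  forall e, e \in S -> x e = 0.

Definition spans C e := exists x,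
  [/\ L x, forall e', e' \notin e |: C -> x e' = 0 & x e != 0].

Lemma spansS C B e : C \subset B -> spans C e -> spans B e.
Proof.
move=> CB [x [Lx x0 xe]]; exists x; split=> // e' e'B; apply: x0.
by apply: contra e'B; apply: subsetP; apply: setUS.
Qed.

Lemma pointed_spans S C s e :
  [disjoint S & C] -> e \in S -> spans C e -> ~ pointed S C s.
Proof.
move=> SC eS [x [Lx x0 xe]].
(* The sign is chosen so that the multiple of [x] conforms at [e]; on the rest of [S] it vanishes.
   The term [0 * x e'] only gives it the shape of [L_comb]. *)
move=> /(_ (fun e' => (if (e \in s) == (0 <= x e) then 1 else -1) * x e' + 0 * x e')) ptd.
have {}ptd : (if (e \in s) == (0 <= x e) then 1 else -1) * x e + 0 * x e = 0.
  apply: ptd => [|e' e'SC|e' e'S|//]; first exact: L_comb.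
    rewrite (x0 e') ?mulr0 ?addr0 //; apply: contra e'SC; rewrite !inE.
    by case/orP=> [/eqP->|->]; rewrite ?eS ?orbT.
  have [->|e'e] := eqVneq e' e; last first.
    rewrite (x0 e') ?mulr0 ?addr0 ?if_same // !inE negb_or e'e.
    by rewrite (disjointFr SC e'S).
  by case: (e \in s); case: (leP 0 (x e)) => h /=; lia.
by move: ptd xe; case: ifP; lia.
Qed.

(* Deletion-contraction at [e]: by [L_comb], two members of the minor that    *)
(* prevent the two extensions of [s] combine to one that vanishes at [e].     *)
Lemma pointed_extensions S C s e :
  [disjoint e |: S & C] -> e \notin S -> s \subset S -> ~ spans C e ->
  [/\ pointed S C s <-> pointed (e |: S) C s \/ pointed (e |: S) C (e |: s)
    & pointed S (e |: C) s <-> pointed (e |: S) C s /\ pointed (e |: S) C (e |: s)].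
Proof.
move=> SC eS sS nspan.
have es : e \notin s by apply: contra eS; apply: subsetP.
have eC : e \notin C by rewrite (disjointFr SC) // setU11.
have supp_e x : L x -> (forall e', e' \notin e |: C -> x e' = 0) -> x e = 0.
  by move=> Lx x0; apply/eqP; apply/negP => /negP xe; apply: nspan; exists x.
have ext b x : conforms s S x -> (if b then 0 <= x e else x e <= 0) ->
    conforms (if b then e |: s else s) (e |: S) x.
  move=> xs xe e'; rewrite 2!inE; have [->|e'e] /= := eqVneq e' e.
    by case: b xe; rewrite ?setU11 ?(negPf es).
  move=> /xs; case: b {xe}; rewrite ?inE ?(negPf e'e) //=.
have res b x : conforms (if b then e |: s else s) (e |: S) x -> conforms s S x.
  move=> xs e' e'S; have := xs e'; rewrite !inE e'S orbT => /(_ isT).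
  case: b {xs} => //; rewrite !inE.
  by have [e'e|//] := eqVneq e' e; rewrite -e'e e'S in eS.
have del b : pointed (e |: S) C (if b then e |: s else s) -> pointed S C s.
  move=> ptd x Lx x0 xs e' e'S; apply: (ptd x) => //; last by rewrite inE e'S orbT.
    by move=> e'' H; apply: x0; apply: contra H; rewrite !inE -orbA => ->; rewrite orbT.
  have xe : x e = 0 by rewrite x0 // inE negb_or eS eC.
  by apply: ext => //; case: b {ptd}; rewrite xe.
have con b : pointed S (e |: C) s -> pointed (e |: S) C (if b then e |: s else s).
  move=> ptd x Lx x0 xs.
  have xS e' : e' \in S -> x e' = 0.
    apply: (ptd x) => //; last exact: res xs.
    by move=> e'' H; apply: x0; rewrite setUCA setUA in H.
  move=> e'; rewrite inE => /orP[/set1P->|/xS//].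
  apply: supp_e => // e'' H.
  case e''S: (e'' \in S); first exact: xS.
  by apply: x0; rewrite -setUA setUCA inE e''S.
split; split.
- move=> ptd; apply: contrapT => /not_orP[].
  move=> /existsNP[x /not_implyP[Lx /not_implyP[x0 /not_implyP[xs xn0]]]].
  move=> /existsNP[y /not_implyP[Ly /not_implyP[y0 /not_implyP[ys yn0]]]].
  have xe0 : x e <= 0 by have := xs e (setU11 _ _); rewrite (negPf es).
  have ye0 : 0 <= y e by have := ys e (setU11 _ _); rewrite setU11.
  have off z : L z -> (forall e', e' \notin (e |: S) :|: C -> z e' = 0) ->
      conforms s S z -> z e = 0 -> forall e', e' \in e |: S -> z e' = 0.
    move=> Lz z0 zs ze e'; rewrite inE => /orP[/set1P->//|]; apply: (ptd z) => //.
    move=> e'' H; have [->//|e''e] := eqVneq e'' e.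
    by apply: z0; rewrite -setUA inE (negPf H) inE (negPf e''e).
  have xs' := res false x xs; have ys' := res true y ys.
  have [xe|xe] := eqVneq (x e) 0; first by apply: xn0; apply: off.
  have [ye|ye] := eqVneq (y e) 0; first by apply: yn0; apply: off.
  have z0 : forall e', e' \in S -> y e * x e' + - x e * y e' = 0.
    apply: (ptd (fun e' => y e * x e' + - x e * y e')); first exact: L_comb.
      move=> e' H; have [->|e'e] := eqVneq e' e; first by lia.
      have e'0 : e' \notin (e |: S) :|: C by rewrite -setUA inE (negPf H) inE (negPf e'e).
    by rewrite (x0 e') // (y0 e') // !mulr0 addr0.
    move=> e' e'S; have := xs' e' e'S; have := ys' e' e'S.
    by case: ifP => _ *; nia.
  (* The coefficients [y e] and [- x e] are positive, and at each edge of [S] the two terms of the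
     combination have the same sign. As they add up to 0, [x] vanishes on [S], and so witnesses that
     [C] spans [e]. *)
  apply: nspan; exists x; split=> // e' e'eC.
  case e'S: (e' \in S); last by apply: x0; rewrite -setUA setUCA inE e'S.
  have := xs' e' e'S; have := ys' e' e'S; have := z0 e' e'S.
  by case: ifP => _ *; nia.
- by case; [exact: (del false)|exact: (del true)].
- move=> ptd; split; [exact: (con false)|exact: (con true)].
move=> [ptd0 ptd1] x Lx x0 xs e' e'S.
have H e'' : e'' \notin (e |: S) :|: C -> x e'' = 0.
  by rewrite -setUA setUCA; apply: x0.
have e'eS : e' \in e |: S by rewrite inE e'S orbT.
(* The sign of [x e] decides to which of the two extensions [x] conforms. *)
have /orP[xe|xe] := le_total 0 (x e).
  by apply: (ptd1 x) => //; apply: (ext true).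
by apply: (ptd0 x) => //; apply: (ext false).
Qed.

Variable d : {set E} -> nat.
Hypothesis d_step : forall C e, e \notin C ->
  d (e |: C) = (d C + `[< spans C e >])%N.

(** If [C] spans [e], no sign vector is pointed, and the terms of [B] and [e |: B] cancel. Otherwise
    sort the sign vectors on [e |: S] by their value at [e]: by [pointed_extensions] the union of
    the two families belongs to the deletion of [e] and their intersection to the contraction, so
    the two counts add up ([cardsUI]). *)
Lemma card_pointed S C : [disjoint S & C] ->
  #|[set s : {set E} | s \subset S & `[< pointed S C s >]]|%:Z =
  \sum_(B : {set E} | B \subset S) (-1) ^+ (d (B :|: C) + d C).
Proof.
elim/set_ind: S C => [|e S eS IH] C SC.
  rewrite (big_pred1 set0) => [|B]; last by rewrite subset0.
  rewrite set0U addnn -signr_odd odd_double expr0.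
  rewrite (_ : [set _ | _ & _] = [set set0]) ?cards1 //.
  apply/setP=> s; rewrite !inE subset0; case: eqP => //= _.
  by apply/asboolP => x _ _ _ e; rewrite inE.
have eC : e \notin C by rewrite (disjointFr SC) // setU11.
have [SC' SeC] : [disjoint S & C] /\ [disjoint S & e |: C].
  have SC' : [disjoint S & C] by apply: disjointWl SC; apply: subsetUr.
  split=> //; rewrite disjoint_sym disjoints_subset subUset sub1set inE eS /=.
  by rewrite -disjoints_subset disjoint_sym.
rewrite sum_subset_setU1 //.
have d_e B : B \subset S -> d (e |: B :|: C) = (d (B :|: C) + `[< spans (B :|: C) e >])%N.
  by move=> BS; rewrite -setUA d_step // inE negb_or eC (contra (subsetP BS e) eS).
have [sp|nsp] := pselect (spans C e).
  rewrite (_ : [set _ | _ & _] = set0) ?cards0; last first.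
    apply/setP=> s; rewrite !inE; apply/negP => /andP[_ /asboolP].
    by apply: pointed_spans SC _ sp; rewrite setU11.
  rewrite -big_split big1 //= => B BS; rewrite d_e // asboolT ?addn1; last first.
    by apply: spansS sp; apply: subsetUr.
  by rewrite addSn exprS mulN1r subrr.
rewrite -IH //.
have -> : \sum_(B : {set E} | B \subset S) (-1) ^+ (d (e |: B :|: C) + d C) =
    \sum_(B : {set E} | B \subset S) (-1) ^+ (d (B :|: (e |: C)) + d (e |: C)) :> int.
  by apply: eq_bigr => B BS; rewrite setUCA setUA d_step // asboolF // addn0.
rewrite -IH // -PoszD card_subset_setU1 // -cardsUI; congr (Posz (_ + _)).
  apply: eq_card => s; rewrite !inE -andb_orr; case sS: (s \subset S) => //=.
  have [H _] := pointed_extensions SC eS sS nsp.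
  by rewrite -asbool_or; exact/esym/asbool_equiv_eq.
apply: eq_card => s; rewrite !inE andbACA andbb; case sS: (s \subset S) => //=.
have [_ H] := pointed_extensions SC eS sS nsp.
by rewrite -asbool_and; exact/esym/asbool_equiv_eq.
Qed.

End SignVectors.

(** * Flows and tensions of a graph *)

Lemma drevK (E : finType) : involutive (@drev E).
Proof. by case=> e b; rewrite /drev /= negbK. Qed.

Lemma same_edge (E : finType) (d d' : dart E) :
  d.1 = d'.1 -> d = d' \/ d = drev d'.
Proof. by case: d d' => [e []] [e' []] /= ->; [left|right|right|left]. Qed.

Section Graph.

Variables (E V : finType) (at_ : dart E -> V).
Implicit Types (B S : {set E}) (e : E) (d : dart E) (w : seq (dart E)).
Implicit Types (D : {set dart E}) (u v : V) (X : {set V}).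

Definition step D : rel V :=
  [rel u v | [exists d in D, (at_ d == u) && (at_ (drev d) == v)]].

Fixpoint walk u w v : bool :=
  if w is d :: w' then (at_ d == u) && walk (at_ (drev d)) w' v else u == v.

Lemma walk_cat u w1 w2 v z : walk u w1 v -> walk v w2 z -> walk u (w1 ++ w2) z.
Proof. by elim: w1 u => [|d w1 IH] u /= => [/eqP->//|/andP[-> /IH]]. Qed.

Lemma walk_starts u w v : walk u w v ->
  rcons [seq at_ d | d <- w] v = u :: [seq at_ (drev d) | d <- w].
Proof. by elim: w u => [|d w IH] u /= => [/eqP->|/andP[/eqP-> /IH->]]. Qed.

Lemma walk_cycle u d w : walk u (d :: w) u ->
  path.cycle (fun d d' => at_ (drev d) == at_ d') (d :: w).
Proof.
move=> /= /andP[/eqP <-] {u}.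
suff H d1 : walk (at_ (drev d1)) w (at_ d) =
    path (fun d d' => at_ (drev d) == at_ d') d1 (rcons w d) by rewrite H.
elim: w d1 => [|d' w IH] d1 /=; first by rewrite andbT.
by rewrite IH eq_sym.
Qed.

Lemma cycle_walk d w :
  path.cycle (fun d d' => at_ (drev d) == at_ d') (d :: w) ->
  walk (at_ d) (d :: w) (at_ d).
Proof.
rewrite /= eqxx /=.
suff H d1 : walk (at_ (drev d1)) w (at_ d) =
    path (fun d d' => at_ (drev d) == at_ d') d1 (rcons w d) by rewrite H.
elim: w d1 => [|d' w IH] d1 /=; first by rewrite andbT.
by rewrite IH eq_sym.
Qed.

Lemma connect_walk D u v : connect (step D) u v -> exists w,
  [/\ walk u w v, {subset w <= D} & uniq (u :: [seq at_ (drev d) | d <- w])].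
Proof.
move=> /connectP[p + ->]; case/shortenP => {}p + uniq_p _.
suff: forall u, path (step D) u p -> exists w,
    [/\ walk u w (last u p), {subset w <= D} & [seq at_ (drev d) | d <- w] = p].
  by move=> H /H[w [? ? wp]]; exists w; rewrite wp.
elim: p {u uniq_p} => [|v' p IH] u /=; first by exists [::]; split=> //=.
move=> /andP[/exists_inP[d dD /andP[/eqP du /eqP dv]] /IH[w [wp wD wE]]].
exists (d :: w); rewrite /= du dv wE eqxx; split=> // d'.
by rewrite inE => /predU1P[->|/wD].
Qed.

Lemma walk_connect D u w v : {subset w <= D} -> walk u w v -> connect (step D) u v.
Proof.
elim: w u => [|d w IH] u wD /=; first by move/eqP->; apply: connect0.
move=> /andP[/eqP <- /IH H]; apply: connect_trans (H _).
  by apply: connect1; apply/exists_inP; exists d; rewrite ?wD ?mem_head // !eqxx.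
by move=> d' d'w; rewrite wD // inE d'w orbT.
Qed.

Lemma walk_uniq_edges u w v : walk u w v ->
  uniq (u :: [seq at_ (drev d) | d <- w]) -> uniq [seq d.1 | d <- w].
Proof.
elim: w u => //= d w IH u /andP[/eqP du wv] /andP[u_notin uniq_w].
rewrite (IH _ wv) // andbT; apply/mapP=> -[d' d'w dd'].
case/negP: u_notin; rewrite -du.
have [eqd|eqd] := same_edge dd'.
  by rewrite -(walk_starts wv) mem_rcons inE eqd map_f ?orbT.
by rewrite inE; apply/orP; right; apply/mapP; exists d'; rewrite // eqd.
Qed.

Local Open Scope ring_scope.

(** * Chains of walks, flows across cuts, and potentials *)

Section Values.

Variable M : zmodType.
Implicit Types (x y : E -> M) (p : V -> M).

Definition inflow x v := \sum_(e | at_ (e, false) == v) x e.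
Definition outflow x v := \sum_(e | at_ (e, true) == v) x e.
Definition is_flow x := forall v, inflow x v = outflow x v.

Definition diff p e := p (at_ (e, false)) - p (at_ (e, true)).

(** The 1-chain of a walk with coefficient [m]; edges traversed several times are counted with
    multiplicity and direction. *)
Definition chain (m : M) w e :=
  \sum_(d <- w) (if d.1 == e then if d.2 then m else - m else 0).

Lemma chain_notin m w e : e \notin [seq d.1 | d <- w] -> chain m w e = 0.
Proof.
move=> ew; rewrite /chain big_seq big1 // => d dw; case: eqP => // de.
by case/mapP: ew; exists d.
Qed.

Lemma chain_cons m d w e : chain m (d :: w) e =
  (if d.1 == e then if d.2 then m else - m else 0) + chain m w e.
Proof. by rewrite /chain big_cons. Qed.

Lemma chain_uniq m w d : uniq [seq d.1 | d <- w] -> d \in w ->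
  chain m w d.1 = if d.2 then m else - m.
Proof.
elim: w => //= d' w IH /andP[d'w uw]; rewrite chain_cons inE => /predU1P[->|dw].
  by rewrite eqxx chain_notin // addr0.
rewrite IH // (_ : _ == _ = false) ?add0r //; apply: contraNF d'w => /eqP->.
exact: map_f.
Qed.

(** The boundary of the chain telescopes to [m] times the end minus the start of the walk; it is
    written without subtraction. *)
Lemma chain_bounds m u w v z : walk u w v ->
  inflow (chain m w) z + (if z == u then m else 0) =
  outflow (chain m w) z + (if z == v then m else 0).
Proof.
elim: w u => [|d w IH] u /=.
  move=> /eqP->; congr (_ + _).
  by rewrite /inflow /outflow !big1 // => e _; rewrite /chain big_nil.
move=> /andP[/eqP <- {u} /IH {}IH].
have single b : \sum_(e | at_ (e, b) == z)
    (if d.1 == e then if d.2 then m else - m else 0) =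
    if at_ (d.1, b) == z then if d.2 then m else - m else 0.
  rewrite -big_mkcondr /=; case: (at_ (d.1, b) =P z) => [<-|zb].
    rewrite (big_pred1 d.1) // => e /=; rewrite (eq_sym e).
    by case: (d.1 =P e) => [<-|_]; rewrite ?eqxx ?andbF.
  by rewrite big1 // => e /andP[/eqP ez /eqP de]; case: zb; rewrite de.
rewrite /inflow /outflow (eq_bigr _ (fun e _ => chain_cons m d w e)).
rewrite [in RHS](eq_bigr _ (fun e _ => chain_cons m d w e)) !big_split /= !single !(eq_sym _ z).
case: d IH {single} => e [] /=; rewrite /drev /= => IH.
  by rewrite [X in X + _ = _]addrC IH -[RHS]addrA [RHS]addrC.
have opp_if b : (if b then - m else 0) = - (if b then m else 0).
  by case: b; rewrite ?oppr0.
by rewrite !opp_if addrAC addNr add0r -addrA -IH [X in _ = _ + X]addrC addKr.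
Qed.

Lemma closed_walk_flow m u w : walk u w u -> is_flow (chain m w).
Proof. by move=> /(chain_bounds m) H z; apply: addIr (H z). Qed.

(** Add up conservation over [X]: an edge inside [X] occurs on both sides, so this is the balance of
    the flow across the cut. *)
Lemma flow_cut x X : is_flow x ->
  \sum_(e | at_ (e, false) \in X) x e = \sum_(e | at_ (e, true) \in X) x e.
Proof.
move=> flow_x.
have part b : \sum_(e | at_ (e, b) \in X) x e =
    \sum_(v in X) \sum_(e | at_ (e, b) == v) x e.
  rewrite (partition_big (fun e => at_ (e, b)) (mem X)) //=.
  by apply: eq_bigr => v vX; apply: eq_bigl => e; case: eqP => [->|];
    rewrite ?vX ?andbF.
by rewrite !part; apply: eq_bigr => v _; apply: flow_x.
Qed.

Lemma walk_diff p u w v : walk u w v ->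
  \sum_(d <- w) (if d.2 then diff p d.1 else - diff p d.1) = p v - p u.
Proof.
elim: w u => [|[e b] w IH] u /=; first by move=> /eqP->; rewrite big_nil subrr.
move=> /andP[/eqP <- /IH {}IH]; rewrite big_cons IH /diff /drev.
by case: b {IH} => /=; rewrite ?opprB addrC addrA subrK.
Qed.

End Values.

Definition darts B : {set dart E} := [set d | d.1 \in B].

Definition joined B e := connect (step (darts B)) (at_ (e, false)) (at_ (e, true)).

Definition component B e := [set v | connect (step (darts B)) (at_ (e, false)) v].

Lemma component_closed B e e' b : e' \in B ->
  (at_ (e', b) \in component B e) = (at_ (e', ~~ b) \in component B e).
Proof.
move=> e'B; rewrite !inE.
apply/idP/idP => /connect_trans; apply; apply: connect1; apply/exists_inP.
  by exists (e', b); rewrite ?inE //= !eqxx.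
by exists (e', ~~ b); rewrite ?inE //= /drev /= negbK !eqxx.
Qed.

Lemma component_head B e : at_ (e, false) \in component B e.
Proof. by rewrite inE connect0. Qed.

Lemma component_tail B e : (at_ (e, true) \in component B e) = joined B e.
Proof. by rewrite inE. Qed.

(** A walk in [B] from the head of [e] to its tail is closed up by [e] itself. *)
Lemma joined_flow (M : zmodType) (m : M) B e : e \notin B -> joined B e ->
  exists x, [/\ is_flow x, forall e', e' \notin e |: B -> x e' = 0 & x e = m].
Proof.
move=> eB /connect_walk[w [ww wB _]].
have off e' : e' \notin B -> e' \notin [seq d.1 | d <- w].
  by apply: contra => /mapP[d /wB + ->]; rewrite inE.
exists (chain m ((e, true) :: w)); split.
- by apply: (@closed_walk_flow _ _ (at_ (e, true))); rewrite /= eqxx.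
- move=> e'; rewrite !inE negb_or eq_sym => /andP[/negPf ee' e'B].
  by rewrite chain_cons /= ee' add0r chain_notin ?off.
- by rewrite chain_cons /= eqxx chain_notin ?addr0 ?off.
Qed.

(** Among the edges of [e |: B], only [e] leaves or enters the component of its head, and a flow has
    no net value across a cut. *)
Lemma unjoined_flow (M : zmodType) (x : E -> M) B e : ~~ joined B e ->
  is_flow x -> (forall e', e' \notin e |: B -> x e' = 0) -> x e = 0.
Proof.
rewrite -component_tail => je fx x0; have := @flow_cut _ x (component B e) fx.
rewrite big_mkcond [RHS]big_mkcond /= (bigD1 e) // [RHS](bigD1 e) //=.
rewrite component_head (negPf je).
rewrite (eq_bigr (fun e' => if at_ (e', true) \in component B e then x e' else 0)).
  by move/addIr.
move=> e' e'e; have [e'B|e'B] := boolP (e' \in B).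
  by rewrite component_closed.
by rewrite x0 ?if_same // !inE negb_or e'e.
Qed.

Lemma joined_diff (M : zmodType) (p : V -> M) B e : joined B e ->
  (forall e', e' \in B -> diff p e' = 0) -> diff p e = 0.
Proof.
move=> /connect_walk[w [/(walk_diff p) + wB _]] p0.
rewrite big_seq big1 => [H|d /wB]; last by rewrite inE => /p0->; rewrite oppr0 if_same.
by rewrite /diff -opprB -H oppr0.
Qed.

(** The potential is [m] on the component of the head of [e] and 0 elsewhere. *)
Lemma unjoined_diff (M : zmodType) (m : M) B e : ~~ joined B e ->
  exists p, (forall e', e' \in B -> diff p e' = 0) /\ diff p e = m.
Proof.
rewrite -component_tail => je.
exists (fun v => if v \in component B e then m else 0); split.
  by move=> e' e'B; rewrite /diff component_closed //= subrr.
by rewrite /diff component_head (negPf je) subr0.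
Qed.

(** * Numbers of flows and tensions, edge by edge *)

Section Counting.

Variable M : finZmodType.
Implicit Types (x : {ffun E -> M}).

Definition flow_set B := 
  [set x : {ffun E -> M} | supp x \subset B & [forall v, inflow x v == outflow x v]].

(** Tensions of the graph with edge set [S] that vanish on [B], given by potentials instead of cycle
    conditions; [tensionsE] links the two. *)
Definition tension_set S B := [set x : {ffun E -> M} | supp x \subset S :\: B &
  [exists p : {ffun V -> M}, [forall e in S, x e == diff p e]]].

(** Evaluation at [e] maps the subgroup [A] onto [M], with section [g], so [A] has as many elements
    as the kernel times [M]. *)
Lemma card_eval (A : {set {ffun E -> M}}) e (g : M -> {ffun E -> M}) :
  (forall x y, x \in A -> y \in A -> x - y \in A) ->
  (forall m, g m \in A) -> (forall m, g m e = m) ->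
  #|A| = (#|[set x in A | x e == 0%R]| * #|M|)%N.
Proof.
move=> AB gA ge.
have A0 : 0 \in A by rewrite -(subrr (g 0)) AB.
have AD x y : x \in A -> y \in A -> x + y \in A.
  by move=> xA yA; rewrite -[y]opprK -[- y]sub0r !AB.
rewrite -cardsT -cardsX.
rewrite -(@card_in_imset _ _ (fun u : {ffun E -> M} * M => u.1 + g u.2)).
  apply: eq_card => y; apply/idP/imsetP => [yA|[[x m] + ->]].
    exists (y - g (y e), y e); last by rewrite subrK.
    by rewrite !inE AB //= !ffunE ge subrr eqxx.
  by rewrite !inE andbT => /andP[xA _]; apply: AD.
move=> [x m] [y n]; rewrite !inE !andbT /= => /andP[_ /eqP xe] /andP[_ /eqP ye] eqxy.
have mn : m = n by move/ffunP/(_ e): (eqxy); rewrite !ffunE xe ye !add0r !ge.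
by move: eqxy; rewrite mn => /addIr->.
Qed.

Lemma supp_subP x B : reflect (forall e, e \notin B -> x e = 0) (supp x \subset B).
Proof.
apply: (iffP subsetP) => [H e eB|H e].
  by apply: contraNeq eB => xe; apply: H; rewrite inE.
by rewrite inE; apply: contraNT => /H->; rewrite eqxx.
Qed.

Lemma flow_setP x B :
  reflect ((forall e, e \notin B -> x e = 0) /\ is_flow x) (x \in flow_set B).
Proof.
rewrite inE; apply: (iffP andP) => -[/supp_subP xB H]; split=> //.
  by move=> v; apply/eqP; move/forallP: H.
by apply/forallP => v; apply/eqP.
Qed.

Lemma card_flow_step B e : e \notin B ->
  #|flow_set (e |: B)| = (#|flow_set B| * #|M| ^ joined B e)%N.
Proof.
move=> eB.
have flow_setE : [set x in flow_set (e |: B) | x e == 0] = flow_set B.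
  apply/setP=> x; rewrite inE; apply/andP/flow_setP => [[/flow_setP[x0 fx] /eqP xe]|[x0 fx]].
    split=> // e' e'B; have [->//|e'e] := eqVneq e' e.
    by apply: x0; rewrite !inE negb_or e'e.
  split; last by rewrite x0.
  by apply/flow_setP; split=> // e'; rewrite !inE negb_or => /andP[_ /x0].
have [je|je] := boolP (joined B e); last first.
  rewrite expn0 muln1 -flow_setE; apply: eq_card => x; rewrite [RHS]inE.
  by case: flow_setP => //= -[x0 fx]; rewrite (unjoined_flow je) ?eqxx.
have /choice[g gP] := fun m : M => joined_flow m eB je.
rewrite (@card_eval _ e (fun m => [ffun e' => g m e'])) ?flow_setE ?expn1 //.
- move=> x y /flow_setP[x0 fx] /flow_setP[y0 fy]; apply/flow_setP; split.
    by move=> e' e'B; rewrite !ffunE x0 // y0 // subrr.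
  move=> v; rewrite /inflow /outflow.
  under eq_bigr do rewrite !ffunE.
  under [RHS]eq_bigr do rewrite !ffunE.
  by rewrite !sumrB; congr (_ - _); [apply: fx|apply: fy].
- move=> m; have [fg g0 _] := gP m; apply/flow_setP; split.
    by move=> e' e'B; rewrite ffunE g0.
  by move=> v; rewrite /inflow /outflow; under eq_bigr do rewrite ffunE;
     under [RHS]eq_bigr do rewrite ffunE; apply: fg.
- by move=> m; rewrite ffunE; have [] := gP m.
Qed.

Lemma flow_set0 : flow_set set0 = [set (0 : {ffun E -> M})].
Proof.
apply/setP=> x; apply/flow_setP/set1P => [[x0 _]|->].
  by apply/ffunP => e; rewrite x0 ?ffunE // inE.
split=> [e _|v]; first by rewrite ffunE.
by rewrite /inflow /outflow !big1 // => e _; rewrite ffunE.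
Qed.

Lemma tension_setP x S B :
  reflect ((forall e, e \notin S :\: B -> x e = 0) /\
           exists p, forall e, e \in S -> x e = diff p e) (x \in tension_set S B).
Proof.
rewrite inE; apply: (iffP andP) => -[/supp_subP xB]; [move/existsP|]; move=> [p pP]; split=> //.
  by exists p => e eS; apply/eqP; move/forall_inP: pP => /(_ e eS).
apply/existsP; exists [ffun v => p v]; apply/forall_inP => e eS.
by rewrite pP // /diff !ffunE.
Qed.

Lemma card_tension_step S B e : B \subset S -> e \in S -> e \notin B ->
  #|tension_set S B| = (#|tension_set S (e |: B)| * #|M| ^ (~~ joined B e))%N.
Proof.
move=> BS eS eB.
have tension_setE : [set x in tension_set S B | x e == 0] = tension_set S (e |: B).
  apply/setP=> x; rewrite inE; apply/andP/tension_setP => [[/tension_setP[x0 px] /eqP xe]|[x0 px]].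
    split=> // e' e'B; have [->//|e'e] := eqVneq e' e.
    by apply: x0; apply: contra e'B; rewrite !inE negb_or e'e.
  split; last by rewrite x0 // !inE eqxx.
  apply/tension_setP; split=> // e' e'B; apply: x0; apply: contra e'B.
  by rewrite !inE negb_or => /andP[/andP[_ ->] ->].
have [je|je] := boolP (joined B e).
  rewrite expn0 muln1 -tension_setE; apply: eq_card => x; rewrite [RHS]inE.
  case: tension_setP => //= -[x0 [p px]]; rewrite px // (joined_diff je) ?eqxx //.
  by move=> e' e'B; rewrite -px ?(subsetP BS) // x0 // !inE e'B.
have /choice[g gP] := fun m : M => unjoined_diff m je.
rewrite (@card_eval _ e (fun m => [ffun e' => if e' \in S then diff (g m) e' else 0])).
- by rewrite tension_setE expn1.
- move=> x y /tension_setP[x0 [p px]] /tension_setP[y0 [q qy]].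
  apply/tension_setP; split.
    by move=> e' e'B; rewrite !ffunE x0 // y0 // subrr.
  exists (fun v => p v - q v) => e' e'S; rewrite !ffunE px // qy // /diff.
  by rewrite !opprD addrACA.
- move=> m; have [g0 _] := gP m; apply/tension_setP; split.
    move=> e'; rewrite ffunE !inE negb_and negbK => /orP[e'B|/negPf->//].
    by rewrite g0 // if_same.
  by exists (g m) => e' e'S; rewrite ffunE e'S.
- by move=> m; rewrite ffunE eS; have [] := gP m.
Qed.

Lemma tension_set_id S : tension_set S S = [set (0 : {ffun E -> M})].
Proof.
apply/setP=> x; apply/tension_setP/set1P => [[x0 _]|->].
  by apply/ffunP => e; rewrite x0 ?ffunE // setDv inE.
split=> [e _|]; first by rewrite ffunE.
by exists (fun=> 0) => e _; rewrite /diff subrr ffunE.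
Qed.

End Counting.

(* By [card_flow_set] and [card_tension_set], Z/2Z may be replaced by any      *)
(* finite abelian group here.                                                 *)
Definition flow_dim B := logn 2 #|flow_set (Zmod 2) B|.
Definition tension_dim S B := logn 2 #|tension_set (Zmod 2) S B|.

Lemma flow_dim_step B e : e \notin B ->
  flow_dim (e |: B) = (flow_dim B + joined B e)%N.
Proof.
move=> eB; rewrite /flow_dim card_flow_step // card_ord /=.
rewrite lognM ?lognX ?muln1 ?expn_gt0 //; apply/card_gt0P; exists 0.
apply/flow_setP; split=> [e' _|v]; first by rewrite ffunE.
by rewrite /inflow /outflow !big1 // => e' _; rewrite ffunE.
Qed.

Lemma tension_dim_step S B e : B \subset S -> e \in S -> e \notin B ->
  tension_dim S B = (tension_dim S (e |: B) + ~~ joined B e)%N.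
Proof.
move=> BS eS eB; rewrite /tension_dim (card_tension_step _ BS eS eB) card_ord /=.
rewrite lognM ?lognX ?muln1 ?expn_gt0 //; apply/card_gt0P; exists 0.
apply/tension_setP; split=> [e' _|]; first by rewrite ffunE.
by exists (fun=> 0) => e' _; rewrite /diff subrr ffunE.
Qed.

Lemma card_flow_set (M : finZmodType) B : #|flow_set M B| = (#|M| ^ flow_dim B)%N.
Proof.
elim/set_ind: B => [|e B eB IH]; first by rewrite /flow_dim !flow_set0 !cards1 logn1.
by rewrite card_flow_step // flow_dim_step // expnD IH.
Qed.

Lemma setU1_setDU1 S (C : {set E}) e : e \in S -> e \notin C ->
  e |: (S :\: (e |: C)) = S :\: C.
Proof.
by move=> eS eC; apply/setP=> e'; rewrite !inE; case: eqP => // ->; rewrite eS eC.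
Qed.

Lemma setD_ind S (P : {set E} -> Prop) : P S ->
  (forall e B, B \subset S -> e \in S -> e \notin B -> P (e |: B) -> P B) ->
  forall B, B \subset S -> P B.
Proof.
move=> PS PU; suff H (C : {set E}) : C \subset S -> P (S :\: C).
  move=> B BS; have <- : S :\: (S :\: B) = B by rewrite setDDr setDv set0U (setIidPr BS).
  by apply: H; apply: subsetDl.
elim/set_ind: C => [|e C eC IH]; first by rewrite setD0.
rewrite subUset sub1set => /andP[eS /IH PSC]; apply: (PU e) => //.
- exact: subsetDl.
- by rewrite !inE eqxx.
- by rewrite setU1_setDU1.
Qed.

Lemma card_tension_set (M : finZmodType) S B : B \subset S ->
  #|tension_set M S B| = (#|M| ^ tension_dim S B)%N.
Proof.
move: B; apply: setD_ind => [|e B BS eS eB IH].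
  by rewrite /tension_dim !tension_set_id !cards1 logn1.
by rewrite (card_tension_step _ BS eS eB) (tension_dim_step BS eS eB) expnD IH.
Qed.

(** Rank-nullity. Adding [e] to [B] either raises [flow_dim B] or lowers [tension_dim S B],
    according as [B] joins the ends of [e] or not. *)
Lemma tension_flow_dim S B : B \subset S ->
  (tension_dim S B + #|B| + flow_dim S = #|S| + flow_dim B)%N.
Proof.
move: B; apply: setD_ind => [|e B BS eS eB].
  by rewrite /tension_dim tension_set_id cards1 logn1.
rewrite cardsU1 eB flow_dim_step // (tension_dim_step BS eS eB).
by case: (joined B e); lia.
Qed.

(** * Integer flows and cuts as instances of the sign vector count *)

Definition int_flow (x : E -> int) := is_flow x.
Definition int_cut S (x : E -> int) :=
  exists p, forall e, x e = if e \in S then diff p e else 0.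

Lemma int_flow_comb (a b : int) x y :
  int_flow x -> int_flow y -> int_flow (fun e => a * x e + b * y e).
Proof.
move=> fx fy v; rewrite /inflow /outflow !big_split -!mulr_sumr.
by congr (_ * _ + _ * _); [apply: fx|apply: fy].
Qed.

Lemma int_cut_comb S (a b : int) x y :
  int_cut S x -> int_cut S y -> int_cut S (fun e => a * x e + b * y e).
Proof.
move=> [p px] [q qy]; exists (fun v => a * p v + b * q v) => e.
by rewrite px qy /diff; case: ifP => _; lia.
Qed.

(** The dimension is counted over Z/2Z and [spans] speaks of integers, but [joined] decides both. *)
Lemma int_flow_step (C : {set E}) e : e \notin C ->
  flow_dim (e |: C) = (flow_dim C + `[< spans int_flow C e >])%N.
Proof.
move=> eC; rewrite flow_dim_step //; congr (_ + nat_of_bool _)%N.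
apply/idP/asboolP => [/(joined_flow (1 : int) eC)[x [fx x0 xe]]|[x [fx x0 xe]]].
  by exists x; split=> //; rewrite xe.
by apply: contraNT xe => je; rewrite (unjoined_flow je fx x0).
Qed.

(** A cut supported in [e |: C] has a potential that is constant along the edges of
    [S :\: (e |: C)]. It can be nonzero at an edge [e] of [S] exactly when these edges do not join
    the ends of [e], which is also when the dimension grows. *)
Lemma int_cut_step S (C : {set E}) e : e \notin C ->
  tension_dim S (S :\: (e |: C)) =
  (tension_dim S (S :\: C) + `[< spans (int_cut S) C e >])%N.
Proof.
move=> eC; have [eS|eS] := boolP (e \in S); last first.
  have -> : S :\: (e |: C) = S :\: C.
    by apply/setP=> e'; rewrite !inE; case: eqP => //= ->; rewrite (negPf eS) andbF.
  rewrite asboolF ?addn0 // => -[x [[p px] _]].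
  by rewrite px (negPf eS) eqxx.
rewrite (@tension_dim_step _ _ e) ?subsetDl ?inE ?eqxx // setU1_setDU1 //.
congr (_ + nat_of_bool _)%N; set B := S :\: _.
apply/idP/asboolP => [/(unjoined_diff (1 : int))[p [p0 pe]]|[x [[p px] x0 xe]]].
  exists (fun e' => if e' \in S then diff p e' else 0); split.
  - by exists p.
  - by move=> e' e'C; case: ifP => // e'S; apply: p0; rewrite inE e'C.
  - by rewrite eS pe.
apply: contra xe; rewrite px eS => /joined_diff->// e'; rewrite inE => /andP[e'C e'S].
by have := x0 e' e'C; rewrite px e'S.
Qed.

Lemma card_pointed_flow S :
  #|[set s : {set E} | s \subset S & `[< pointed int_flow S set0 s >]]|%:Z =
  \sum_(B : {set E} | B \subset S) (-1) ^+ flow_dim B.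
Proof.
rewrite (card_pointed int_flow_comb int_flow_step) ?disjoints0 //; last first.
  by rewrite disjoint_sym disjoints_subset sub0set.
apply: eq_bigr => B _; rewrite setU0; congr (_ ^+ _).
by rewrite /flow_dim flow_set0 cards1 logn1 addn0.
Qed.

Lemma card_pointed_cut S (Z : {set E}) : Z \subset S ->
  #|[set s : {set E} | s \subset Z & `[< pointed (int_cut S) Z set0 s >]]|%:Z =
  \sum_(B : {set E} | B \subset Z) (-1) ^+ tension_dim S (S :\: B).
Proof.
move=> ZS; rewrite (card_pointed (@int_cut_comb S) (@int_cut_step S)); last first.
  by rewrite disjoint_sym disjoints_subset sub0set.
apply: eq_bigr => B _; rewrite setU0 setD0; congr (_ ^+ _).
by rewrite [X in (_ + X)%N]/tension_dim tension_set_id cards1 logn1 addn0.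
Qed.

End Graph.

(** * Acyclic and totally cyclic orientations *)

Section Orientations.

Variables (E V : finType) (at_ : dart E -> V).
Implicit Types (S s : {set E}) (e : E) (d : dart E) (c w : seq (dart E)).
Implicit Types (o D : {set dart E}) (X : {set V}).

Definition simple_cycle c := [&& c != [::],
  path.cycle (fun d d' => at_ (drev d) == at_ d') c,
  uniq [seq at_ d | d <- c] & uniq [seq d.1 | d <- c]].

Definition out_closed D X := forall d, d \in D -> at_ d \in X -> at_ (drev d) \in X.

Lemma walk_out_closed D X u w v : out_closed D X -> {subset w <= D} ->
  walk at_ u w v -> u \in X -> v \in X.
Proof.
move=> DX; elim: w u => [|d w IH] u wD /=; first by move/eqP->.
move=> /andP[/eqP <- /IH H] /DX; rewrite wD ?mem_head // => /(_ isT).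
by apply: H => d' d'w; rewrite wD // inE d'w orbT.
Qed.

Lemma simple_cycle_rot c d : simple_cycle c -> d \in c -> exists w,
  [/\ walk at_ (at_ d) (d :: w) (at_ d), simple_cycle (d :: w) & d :: w =i c].
Proof.
move=> /and4P[_ cyc_c uniq_at uniq_e] /rot_to[i w rot_c].
have cyc_dw : path.cycle (fun d d' => at_ (drev d) == at_ d') (d :: w).
  by rewrite -rot_c rot_cycle.
exists w; split; first exact: cycle_walk.
  by rewrite /simple_cycle cyc_dw -rot_c !map_rot !rot_uniq uniq_at uniq_e rot_c.
by move=> d'; rewrite -rot_c mem_rot.
Qed.

(* Minty's alternative: if the tail of [d] cannot be reached from its head,   *)
(* then the set of the reachable vertices is a directed cut.                  *)
Lemma cycle_or_cut D d : (forall d', d' \in D -> drev d' \notin D) -> d \in D ->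
  (exists2 c, simple_cycle c & {subset c <= D} /\ d \in c) \/
  (exists2 X, out_closed D X & at_ d \notin X /\ at_ (drev d) \in X).
Proof.
move=> D_anti dD; pose X := [set v | connect (step at_ D) (at_ (drev d)) v].
have [|dX] := boolP (at_ d \in X); last first.
  right; exists X; last by rewrite dX inE connect0.
  move=> d' d'D; rewrite !inE => /connect_trans; apply; apply: connect1.
  by apply/exists_inP; exists d'; rewrite ?eqxx.
rewrite inE => /connect_walk[w [ww wD w_uniq]]; left; exists (d :: w); last first.
  by split; [move=> d'; rewrite inE => /predU1P[->|/wD]|rewrite mem_head].
have starts := walk_starts ww.
have w_at : uniq (rcons [seq at_ d | d <- w] (at_ d)) by rewrite starts.
rewrite /simple_cycle (walk_cycle (u := at_ d)) /= ?eqxx //.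
rewrite (walk_uniq_edges ww w_uniq) -rcons_uniq w_at andbT /=.
apply/mapP=> -[d' d'w dd'].
have [eqd|eqd] := same_edge dd'.
  by move: w_at; rewrite rcons_uniq eqd (map_f at_ d'w).
by have := D_anti _ (wD _ d'w); rewrite -eqd dD.
Qed.

Definition no_cut D := forall X, out_closed D X ->
  forall d, d \in D -> (at_ d \in X) = (at_ (drev d) \in X).

Lemma cycles_no_cut D : (forall d, d \in D -> drev d \notin D) ->
  (forall d, d \in D -> exists2 c, simple_cycle c & {subset c <= D} /\ d \in c) <->
  no_cut D.
Proof.
move=> D_anti; split=> [D_cyc X DX d dD|D_cut d dD]; last first.
  have [//|[X /D_cut/(_ d dD) + [dX dX']]] := cycle_or_cut D_anti dD.
  by rewrite dX' (negPf dX).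
apply/idP/idP => [|dX]; first exact: DX.
have [c c_cyc [cD dc]] := D_cyc d dD.
have [w [/andP[_ ww] _ wc]] := simple_cycle_rot c_cyc dc.
apply: walk_out_closed DX _ ww dX => d' d'w; apply: cD.
by rewrite -wc inE d'w orbT.
Qed.

(** The orientation of a sign vector: [s] is the set of the edges directed as in the reference
    orientation, so a conforming function is nonnegative along the darts. *)
Definition orient S s : {set dart E} := [set d | (d.1 \in S) && (d.2 == (d.1 \in s))].

Lemma orient_anti S s d : d \in orient S s -> drev d \notin orient S s.
Proof.
by rewrite !inE /= => /andP[-> /eqP->]; case: (_ \in s).
Qed.

Lemma mem_orient S s e : e \in S -> (e, e \in s) \in orient S s.
Proof. by move=> eS; rewrite inE /= eS eqxx. Qed.

(** A directed cycle carries a conforming flow with value 1 along it. Conversely, direct the support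
    of a conforming flow: by Minty's alternative, an edge of it that lies in no directed cycle lies
    in a directed cut, across which the flow passes one way only, although its net value is 0. *)
Lemma pointed_flowP S s :
  pointed (int_flow at_) S set0 s <->
  ~ exists2 c, simple_cycle c & {subset c <= orient S s}.
Proof.
split=> [ptd [c c_cyc cs]|acyc x fx x0 xs e eS].
  have [d dc] : exists d, d \in c.
    by case: c c_cyc {cs} => // d c _; exists d; rewrite mem_head.
  have [w [ww /and4P[_ _ _ w_uniq] wc]] := simple_cycle_rot c_cyc dc.
  have dS : d.1 \in S by have := cs d dc; rewrite inE => /andP[].
  have ws d' : d' \in d :: w -> (d'.1 \in S) && (d'.2 == (d'.1 \in s)).
    by rewrite wc => /cs; rewrite inE.
  have := ptd (chain 1 (d :: w)) (closed_walk_flow _ ww) _ _ d.1 dS.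
  rewrite (chain_uniq _ w_uniq) ?mem_head //.
  move=> H; suff: (if d.2 then 1 else -1 : int)%R = 0%R by case: d.2.
  apply: H => [e eS|e eS].
    rewrite chain_notin //; apply: contra eS => /mapP[d' /ws/andP[+ _] ->].
    by rewrite inE => ->.
  have [/mapP[d' d'w ->]|ew] := boolP (e \in [seq d.1 | d <- d :: w]).
    by rewrite (chain_uniq _ w_uniq) //; have /andP[_ /eqP ->] := ws d' d'w; case: (d'.1 \in s).
  by rewrite chain_notin // if_same.
apply/eqP/negP => /negP xe; pose D := [set d in orient S s | x d.1 != 0%R].
have eD : (e, e \in s) \in D by rewrite inE mem_orient.
have [d|[c c_cyc [cD _]]|[X DX [eX eX']]] := @cycle_or_cut D _ _ eD.
- by rewrite inE => /andP[/orient_anti + _]; rewrite [drev d \in D]inE => /negPf->.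
- by case: acyc; exists c => // d /cD; rewrite inE => /andP[].
(* The net contribution of [e'] across the cut [X], which is nonnegative since [X] is closed under
   the directed support. *)
pose F e' : int := ((if at_ (e', false) \in X then x e' else 0) -
                    (if at_ (e', true) \in X then x e' else 0))%R.
have F_ge0 e' : true -> (0 <= F e')%R.
  move=> _; rewrite /F.
  have [->|xe'] := eqVneq (x e') 0%R; first by rewrite !if_same subrr.
  have e'S : e' \in S by apply: contraNT xe' => e'S; rewrite x0 // setU0.
  have /DX : (e', e' \in s) \in D by rewrite inE mem_orient.
  have := xs e' e'S; rewrite /drev /=; case: (e' \in s) => /= x_e' H.
    by move: H; case: (at_ (e', true) \in X) => [/(_ isT)->|_]; do ?case: ifP; lia.
  by move: H; case: (at_ (e', false) \in X) => [/(_ isT)->|_]; do ?case: ifP; lia.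
have F0 : (\sum_e' F e' = 0)%R.
  by rewrite sumrB -!big_mkcond /=; apply/eqP; rewrite subr_eq0; apply/eqP/flow_cut.
have : F e = 0%R by exact: (psumr_eq0P F_ge0 F0).
move: eX eX'; rewrite /F /drev /=; case: (e \in s) => /= /negPf-> ->; lia.
Qed.

(** The indicator of a set that no dart leaves is a potential whose differences conform to [s];
    conversely, the upper level sets of the potential of a conforming cut are such sets. *)
Lemma pointed_cutP S (Z s : {set E}) : Z \subset S ->
  pointed (int_cut at_ S) Z set0 s <->
  forall X, (forall e, e \in S :\: Z -> (at_ (e, true) \in X) = (at_ (e, false) \in X)) ->
    out_closed (orient Z s) X ->
    forall e, e \in Z -> (at_ (e, true) \in X) = (at_ (e, false) \in X).
Proof.
move=> ZS; split=> [ptd X SX sX e eZ|nocut x [p px] x0 xs e eZ].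
  pose p v : int := (v \in X)%:R%R.
  have := ptd (fun e => if e \in S then diff at_ p e else 0%R) _ _ _ e eZ.
  rewrite (subsetP ZS) // /diff /p => H.
  suff: ((at_ (e, false) \in X)%:R - (at_ (e, true) \in X)%:R = 0 :> int)%R.
    by case: (_ \in X); case: (_ \in X).
  apply: H => [|e' e'Z|e' e'Z]; first by exists p.
    rewrite setU0 in e'Z; case: ifP => // e'S.
    by rewrite SX ?subrr // inE e'Z.
  have := sX _ (mem_orient s e'Z); rewrite (subsetP ZS) // /drev /=.
  by case: (e' \in s) => /=; do 2!case: (_ \in X) => //; move/(_ isT).
rewrite px (subsetP ZS) // /diff.
(* The place [at_ (e, e \notin s)] is where [e] ends when directed by [s]. The potential does not
   decrease along directed edges, so [X] is closed; if [e] also starts in [X], its two ends have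
   equal potential. *)
pose X := [set v | (p (at_ (e, e \notin s)) <= p v)%R].
have := nocut X _ _ e eZ; have := xs e eZ; rewrite px (subsetP ZS) // /diff.
rewrite !inE => x_e H.
have : (p (at_ (e, e \notin s)) <= p (at_ (e, true)))%R =
    (p (at_ (e, e \notin s)) <= p (at_ (e, false)))%R.
  apply: H => [e' e'Z|d].
    have := x0 e'; rewrite setU0 px; move: e'Z; rewrite inE => /andP[-> ->] /(_ isT).
    by rewrite /diff !inE => /subr0_eq ->.
  rewrite inE => /andP[dZ /eqP d2]; rewrite !inE => /le_trans; apply.
  have := xs d.1 dZ; rewrite px (subsetP ZS) // /diff /drev.
  by case: d d2 {dZ} => e' b /= ->; case: (e' \in s) => /=; lia.
move: x_e; case: (e \in s) => /=; lia.
Qed.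

End Orientations.

Lemma orientation_orient (E : finType) (G : sgraph E) s :
  orientation G (orient (edges G) s).
Proof.
apply/forallP=> d; rewrite !inE /=; case: (_ \in edges G) => //=.
by case: d => e [] /=; case: (e \in s).
Qed.

Lemma orient_orientation (E : finType) (G : sgraph E) o : orientation G o ->
  orient (edges G) [set e in edges G | (e, true) \in o] = o.
Proof.
move=> /forallP oG; apply/setP=> d; rewrite !inE (eqP (oG d)).
case dG: (d.1 \in edges G) => //=; move: dG.
case: d => e [] /= eG; rewrite /drev /= ?eG //=.
  by have := eqP (oG (e, true)); rewrite /= eG /= => ->; case: (_ \in o).
Qed.

Lemma card_orientations (E : finType) (G : sgraph E) (P : pred {set dart E}) :
  #|[set o | orientation G o & P o]| =
  #|[set s : {set E} | s \subset edges G & P (orient (edges G) s)]|.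
Proof.
rewrite -(@card_in_imset _ _ (orient (edges G))).
  apply: eq_card => o; rewrite inE; apply/andP/imsetP => [[oG Po]|[s + ->]].
    exists [set e in edges G | (e, true) \in o]; rewrite ?orient_orientation //.
    by rewrite inE orient_orientation // Po andbT; apply/subsetP=> e; rewrite inE => /andP[].
  by rewrite inE => /andP[_ Ps]; rewrite orientation_orient.
have inj (s : {set E}) : s \subset edges G ->
    s = [set e in edges G | (e, true) \in orient (edges G) s].
  move=> /subsetP sG; apply/setP=> e; rewrite !inE /=.
  by case es: (e \in s); rewrite ?andbF // sG.
by move=> s s'; rewrite !inE => /andP[/inj sE _] /andP[/inj s'E _] eq_s; rewrite sE s'E eq_s.
Qed.

(** * Reciprocity *)

Lemma card_dep_pairs (I J : finType) (P : pred I) (Q : I -> pred J) :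
  #|[set u : I * J | P u.1 & Q u.1 u.2]| = \sum_(i | P i) #|[set j | Q i j]|.
Proof.
rewrite -sum1_card; under eq_bigl do rewrite inE.
rewrite -(pair_big_dep P Q (fun _ _ => 1)) /=.
by apply: eq_bigr => i _; rewrite -sum1_card; apply: eq_bigl => j; rewrite inE.
Qed.

(* The number of nowhere-zero members of [F k] is found by inclusion-exclusion *)
(* over the sets [B] of vanishing.  For the value at [-k], the sum over [B] is *)
(* interchanged with the count of the members vanishing on [B].               *)
Lemma reciprocity (E : finType) (S : {set E})
    (F : forall k, {set {ffun E -> Zmod k}}) (a b : {set E} -> nat)
    (h : {set E} -> nat) (s : bool) (k : nat) : 0 < k ->
  (forall k, 0 < k -> forall x, x \in F k -> supp x \subset S) ->
  (forall k, 0 < k -> forall B : {set E}, B \subset S ->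
    #|[set x in F k | [disjoint B & supp x]]| = k ^ a B) ->
  (forall Z : {set E}, Z \subset S ->
    (h Z)%:Z = \sum_(B : {set E} | B \subset Z) (-1) ^+ b B :> int)%R ->
  (forall B : {set E}, B \subset S -> odd (#|B| + a B) = s (+) odd (b B)) ->
  abs_value_at (fun k => #|[set x in F k | S \subset supp x]|) (- k%:Z)
    (\sum_(x in F k) h (S :\: supp x)).
Proof.
move=> k_gt0 F_S F_card h_sum ab.
pose p : {poly rat} :=
  (\sum_(B : {set E} | B \subset S) ((-1) ^+ #|B|)%:P * 'X^(a B))%R.
have horner_p y :
    (p.[y] = \sum_(B : {set E} | B \subset S) (-1) ^+ #|B| * y ^+ a B)%R.
  by rewrite horner_sum; under eq_bigr do rewrite hornerCM hornerXn.
exists p; rewrite horner_p.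
have exchange j (f : {set E} -> rat) : 0 < j ->
    (\sum_(B : {set E} | B \subset S) f B * j%:R ^+ a B =
     \sum_(x in F j) \sum_(B : {set E} | B \subset S :\: supp x) f B)%R.
  move=> j_gt0.
  have -> : (\sum_(x in F j) \sum_(B : {set E} | B \subset S :\: supp x) f B =
      \sum_(x in F j) \sum_(B : {set E} | B \subset S)
         if [disjoint B & supp x] then f B else 0)%R.
    by apply: eq_bigr => x _; rewrite -big_mkcondr; apply: eq_bigl => B; rewrite subsetD.
  rewrite exchange_big /=; apply: eq_bigr => B BS.
  rewrite -natrX -F_card // -big_mkcondr /= sumr_const mulr_natr.
  by congr (_ *+ _)%R; apply: eq_card => x; rewrite !inE.
split=> [j j_gt0|].
  (* The alternating sum over the subsets of the zero set of [x] is 0 unless this set is empty. *)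
  rewrite horner_p exchange //; under eq_bigr do rewrite sum_sign_subsets.
  rewrite -natr_sum; congr (_%:R)%R; rewrite -sum1_card big_mkcond /= [RHS]big_mkcond.
  apply: eq_bigr => x _; rewrite inE setD_eq0.
  by case: (x \in F j); case: (_ \subset _).
(* The parity hypothesis turns the sign (-1)^(|B| + a B) into (-1)^(b B) up to the global sign given
   by [s]. *)
have -> : (\sum_(B : {set E} | B \subset S) (-1) ^+ #|B| * (- k%:Z)%:~R ^+ a B =
    (-1) ^+ s * \sum_(B : {set E} | B \subset S) (-1) ^+ b B * k%:R ^+ a B :> rat)%R.
  rewrite mulr_sumr; apply: eq_bigr => B BS.
  rewrite rmorphN /= [X in (_ * X)%R = _]exprNn mulrA -exprD mulrA -exprD -pmulrn.
  by rewrite -[in LHS]signr_odd ab // -[in RHS]signr_odd oddD oddb.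
rewrite exchange // normrM normrX normrN1 expr1n mul1r.
have -> : (\sum_(x in F k) \sum_(B : {set E} | B \subset S :\: supp x) (-1) ^+ b B =
   (\sum_(x in F k) h (S :\: supp x))%:R :> rat)%R.
  rewrite natr_sum; apply: eq_bigr => x _.
  rewrite [RHS](_ : _ = (h (S :\: supp x))%:Z%:~R)%R // h_sum ?subsetDl //.
  by rewrite rmorph_sum /=; apply: eq_bigr => B _; rewrite rmorphXn /= rmorphN1.
by rewrite normr_nat.
Qed.

(** The potential is built edge by edge. If the new edge joins two components, one of them is
    shifted to fit; if not, the edge closes a cycle, whose zero sum forces the right value. *)
Lemma potential_exists (E V : finType) (at_ : dart E -> V) (M : finZmodType)
    (x : {ffun E -> M}) (B : {set E}) :
  (forall c, simple_cycle at_ c -> {subset c <= darts B} ->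
     (\sum_(d <- c) dart_value x d)%R = 0%R) ->
  exists p, forall e, e \in B -> x e = diff at_ p e.
Proof.
elim/set_ind: B => [|e B eB IH] cyc_x.
  by exists (fun=> 0%R) => e; rewrite inE.
have [c c_cyc cB|p px] := IH.
  by apply: cyc_x c_cyc _ => d /cB; rewrite !inE => ->; rewrite orbT.
have [je|je] := boolP (joined at_ B e); last first.
  have [q [q0 qe]] := unjoined_diff (x e - diff at_ p e)%R je.
  have diffD e' : diff at_ (fun v => p v + q v)%R e' = (diff at_ p e' + diff at_ q e')%R.
    by rewrite /diff opprD addrACA.
  exists (fun v => p v + q v)%R => e' /setU1P[->|e'B].
    by rewrite diffD qe addrC subrK.
  by rewrite diffD q0 // addr0 px.
exists p => e' /setU1P[->|/px//].
have /connect_walk[w [ww wB w_uniq]] := je.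
have wE : e \notin [seq d.1 | d <- w].
  by apply: contra eB => /mapP[d /wB + ->]; rewrite inE.
have /cyc_x : simple_cycle at_ ((e, true) :: w).
  rewrite /simple_cycle (walk_cycle (u := at_ (e, true))) /= ?eqxx //.
  rewrite (walk_uniq_edges ww w_uniq) wE !andbT -rcons_uniq (walk_starts ww).
  exact: w_uniq.
rewrite big_cons /= => sum0; apply/eqP; rewrite -subr_eq0 /diff opprB -(walk_diff p ww).
rewrite -[X in _ == X]sum0.
  apply/eqP; congr (_ + _)%R; rewrite big_seq [RHS]big_seq; apply: eq_bigr => d /wB.
  by rewrite inE => dB; rewrite /dart_value px.
by move=> d; rewrite !inE => /predU1P[->|/wB]; rewrite ?eqxx // inE orbC => ->.
Qed.

(** * Acyclic orientations and tensions of a graph on a surface *)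

Section Surface.

Variable E : finType.
Implicit Types (G : sgraph E) (A B : {set E}) (o : {set dart E}).

Lemma directed_cycleE G c :
  directed_cycle G c = simple_cycle (vert G) c && all (fun d => d.1 \in edges G) c.
Proof.
rewrite /directed_cycle /simple_closed_walk /closed_walk /simple_cycle.
by case: (c != [::]) => //=; rewrite -!andbA andbC -!andbA.
Qed.

Lemma orient_edges G s c : {subset c <= orient (edges G) s} ->
  all (fun d => d.1 \in edges G) c.
Proof. by move=> cs; apply/allP=> d /cs; rewrite inE => /andP[]. Qed.

Lemma card_AO G : #|AO G| =
  #|[set s : {set E} | s \subset edges G &
      `[< pointed (int_flow (vert G)) (edges G) set0 s >]]|.
Proof.
rewrite card_orientations; apply: eq_card => s; rewrite !inE; congr (_ && _).
apply: asbool_equiv_eq; rewrite pointed_flowP; split=> acyc [c].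
  by move=> c_cyc cs; apply: acyc; exists c; rewrite directed_cycleE c_cyc (orient_edges cs).
by rewrite directed_cycleE => -[/andP[c_cyc _] cs]; apply: acyc; exists c.
Qed.

Lemma edges_delete G A : edges (delete G A) = edges G :\: A.
Proof.
suff H r : edges (foldl (@delete1 E) G r) = edges G :\: [set:: r].
  by rewrite /delete H; congr (_ :\: _); apply/setP=> e; rewrite inE mem_enum.
elim: r G => [|e r IH] G /=; first by rewrite set_nil setD0.
by rewrite IH /= set_cons setDDl.
Qed.

Lemma rot_delete G A : Defs.rot (delete G A) = Defs.rot G.
Proof. by rewrite /delete; elim: (enum A) G => //= e r IH G; rewrite IH. Qed.

Lemma card_AO_delete G A :
  (#|AO (delete G A)|%:Z =
   \sum_(B : {set E} | B \subset edges G :\: A) (-1) ^+ flow_dim (vert G) B)%R.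
Proof. by rewrite card_AO edges_delete /vert rot_delete card_pointed_flow. Qed.

Lemma orientation_anti G o d : orientation G o -> d \in o -> drev d \notin o.
Proof. by move=> /forallP/(_ d)/eqP->; case/andP. Qed.

Lemma orientation_edges G o d : orientation G o -> d \in o -> d.1 \in edges G.
Proof. by move=> /forallP/(_ d)/eqP->; case/andP. Qed.

Lemma orientation_dart G o e : orientation G o -> e \in edges G ->
  exists2 d, d \in o & d.1 = e.
Proof.
move=> oG eG; have := forallP oG (e, true); rewrite eG /= => /eqP.
case e1: ((e, true) \in o); first by exists (e, true).
by move=> /esym/negbFE e0; exists (drev (e, true)).
Qed.

Lemma TCO_no_cut G o : orientation G o -> (o \in TCO G) = `[< no_cut (vert G) o >].
Proof.
move=> oG; rewrite inE oG /=; apply: asbool_equiv_eq.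
rewrite -cycles_no_cut; last by move=> d; apply: (orientation_anti oG).
split=> H => [d dO|e eG].
  have [c [c_cyc cO /mapP[d' d'c dd']]] := H _ (orientation_edges oG dO).
  exists c; first by move: c_cyc; rewrite directed_cycleE => /andP[].
  split=> //; have [->//|dE] := same_edge dd'.
  by have := orientation_anti oG dO; rewrite dE drevK cO.
have [d dO <-] := orientation_dart oG eG; have [c c_cyc [cO dc]] := H d dO.
exists c; split=> //; last exact: map_f.
by rewrite directed_cycleE c_cyc; apply/allP=> d' /cO/(orientation_edges oG).
Qed.

Lemma flowsE (M : finZmodType) G : flows M G = flow_set (vert G) M (edges G).
Proof.
apply/setP=> x; rewrite !inE; case xG: (edge_fun G x); move: (xG); rewrite /edge_fun => -> //=.
have sum_edges b v : (\sum_(e in edges G | vert G (e, b) == v) x e =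
    \sum_(e | vert G (e, b) == v) x e)%R.
  rewrite big_mkcondl; apply: eq_bigr => e _; case: ifP => // eG.
  by move/supp_subP: xG => ->//; rewrite eG.
apply/forall_inP/forallP => [H v|H v _]; last by rewrite !sum_edges; apply: H.
have [/H|vG] := boolP (v \in vertices G); first by rewrite !sum_edges.
rewrite /inflow /outflow !big_pred0 // => e; apply: contraNF vG => /eqP <-; exact: imset_f.
Qed.

Lemma tensionsE (M : finZmodType) G : tensions M G = tension_set (vert G) M (edges G) set0.
Proof.
apply/setP=> x; rewrite !inE setD0; congr (_ && _).
apply/asboolP/existsP => [H|[p /forall_inP px] c].
  have [c c_cyc cG|p px] := @potential_exists _ _ (vert G) _ x (edges G).
    by apply: H; rewrite directed_cycleE c_cyc; apply/allP=> d /cG; rewrite inE.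
  exists [ffun v => p v]; apply/forall_inP => e /px ->; by rewrite /diff !ffunE.
rewrite directed_cycleE => /andP[c_cyc /allP cG].
case: c c_cyc cG => // d c /andP[_ /andP[/cycle_walk cw _]] cG.
transitivity (\sum_(d <- d :: c) (if d.2 then diff (vert G) p d.1 else - diff (vert G) p d.1))%R.
  rewrite big_seq [RHS]big_seq; apply: eq_bigr => d' /cG d'G.
  by rewrite /dart_value (eqP (px _ d'G)).
by rewrite (walk_diff p cw) subrr.
Qed.

Lemma tau_reciprocity G k : 0 < k ->
  abs_value_at (tau G) (- k%:Z)
    #|[set p : {ffun E -> Zmod k} * {set dart E} |
        (p.1 \in tensions (Zmod k) G) & (p.2 \in AO (delete G (supp p.1)))]|.
Proof.
move=> k_gt0; rewrite (card_dep_pairs _ (fun x o => o \in AO (delete G (supp x)))).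
(* The summand has to be a function of the zero set of [x], so the support is written as its
   complement. *)
have -> : \sum_(x in tensions (Zmod k) G) #|[set o in AO (delete G (supp x))]| =
    \sum_(x in tensions (Zmod k) G)
      #|AO (delete G (edges G :\: (edges G :\: supp x)))|.
  apply: eq_bigr => x; rewrite inE => /andP[xG _]; rewrite setDDr setDv set0U.
  by rewrite (setIidPr xG) cardsE.
(* By [tension_flow_dim], the global sign is the parity of the rank of the graph. *)
apply: (@reciprocity E (edges G) (fun k => tensions (Zmod k) G)
    (tension_dim (vert G) (edges G)) (flow_dim (vert G))
    (fun Z => #|AO (delete G (edges G :\: Z))|)
    (odd (#|edges G| + flow_dim (vert G) (edges G)))) => //.
- by move=> j _ x; rewrite inE => /andP[].
- move=> j j_gt0 B BG; transitivity #|tension_set (vert G) (Zmod j) (edges G) B|.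
    apply: eq_card => x; rewrite inE tensionsE !inE setD0 subsetD disjoint_sym.
    by rewrite -!andbA; congr (_ && _); rewrite andbC.
  by rewrite card_tension_set // card_ord prednK.
- by move=> Z ZG; rewrite card_AO_delete setDDr setDv set0U (setIidPr ZG).
- move=> B BG; have := tension_flow_dim (vert G) BG; lia.
Qed.

End Surface.

(** * Contractions and cuts *)

Section Cuts.

Variable E : finType.
Implicit Types (G : sgraph E) (A S Z s : {set E}) (e : E) (d : dart E).
Implicit Types (o Y : {set dart E}) (pi : {perm dart E}).

(** Unions of orbits: sets of vertices or faces are replaced by sets of darts, which remain
    meaningful when a minor changes the permutation. *)
Definition perm_invariant pi Y := forall d, (pi d \in Y) = (d \in Y).

Lemma flipE A d : flip A d = if d.1 \in A then drev d else d.
Proof. by rewrite permE. Qed.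

Lemma flipK A : (flip A * flip A = 1)%g.
Proof. by apply/permP=> d; rewrite permM !permE flip_funK. Qed.

Lemma flipV A : ((flip A)^-1 = flip A)%g.
Proof. by apply/eqP; rewrite eq_invg_mul flipK. Qed.

Lemma porbit_ind pi (P : dart E -> Prop) d d' :
  (forall d, P d -> P (pi d)) -> P d -> d' \in porbit pi d -> P d'.
Proof.
move=> Ppi Pd /porbitP[i ->]; elim: i => [|i IH]; first by rewrite expg0 perm1.
by rewrite expgSr permM; apply: Ppi.
Qed.

Lemma invariant_porbit pi Y d d' : perm_invariant pi Y ->
  porbit pi d = porbit pi d' -> (d \in Y) = (d' \in Y).
Proof.
move=> Ypi dd'; apply/esym; apply: (@porbit_ind pi (fun d' => (d' \in Y) = (d \in Y)) d) => //.
  by move=> d1; rewrite Ypi.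
by rewrite dd' porbit_id.
Qed.

Lemma porbit_perm1 pi d : porbit pi (pi d) = porbit pi d.
Proof. exact: (porbit_perm pi 1). Qed.

Lemma invariantV pi Y : perm_invariant pi^-1 Y <-> perm_invariant pi Y.
Proof.
split=> Ypi d; first by rewrite -[in RHS](permK pi d) Ypi.
by rewrite -[in RHS](permKV pi d) Ypi.
Qed.

(** The common form of two operations: abstract contraction acting on the vertex rotation
    ([rot_abstract_contract]) and codeletion acting on the face permutation
    ([face_perm_codelete]). *)
Definition merge pi e : {perm dart E} :=
  if porbit pi (e, true) == porbit pi (e, false) then pi else (flip [set e] * pi)%g.

(* If the two darts of [e] lie in distinct orbits, then following the orbit   *)
(* of [(e, false)] once around under the merged permutation leads from        *)
(* [(e, true)] to [(e, false)].                                               *)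
Lemma invariant_merge pi e Y : perm_invariant (merge pi e) Y <->
  perm_invariant pi Y /\ ((e, true) \in Y) = ((e, false) \in Y).
Proof.
rewrite /merge; case: eqP => [eq_orb|neq_orb].
  by split=> [Ypi|[]//]; split=> //; apply: invariant_porbit eq_orb.
have flip1 b : flip [set e] (e, b) = (e, ~~ b) by rewrite flipE inE eqxx.
have flip_id d : d.1 != e -> flip [set e] d = d by rewrite flipE inE => /negPf->.
split=> [Ypi|[Ypi eY] d]; last first.
  rewrite permM Ypi; have [de|/flip_id->//] := eqVneq d.1 e.
  by case: d de => _ [] /= ->; rewrite flip1 eY.
have Ye b : (pi (e, b) \in Y) = ((e, ~~ b) \in Y).
  by rewrite -Ypi permM flip1 negbK.
have Yd d : d.1 != e -> (pi d \in Y) = (d \in Y).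
  by move=> de; rewrite -[RHS]Ypi permM flip_id.
have eY : ((e, true) \in Y) = ((e, false) \in Y).
  apply/eqP/negP => /negP neqY.
  have stay i : ((pi ^+ i.+1)%g (e, false) \in Y) = ((e, true) \in Y).
    elim: i => [|i IH]; first by rewrite expg1 Ye.
    rewrite expgSr permM; set d := (pi ^+ i.+1)%g _ in IH *.
    have [de|/Yd->//] := eqVneq d.1 e.
    have [dT|dF] : d = (e, true) \/ d = (e, false).
      by case: (d) de => _ [] /= ->; [left|right].
      case: neq_orb; apply/eqP; rewrite eq_porbit_mem -dT; exact: mem_porbit.
    by move: neqY; rewrite -IH dF eqxx.
  (* With this exponent the power of [pi] is the identity, so the orbit is back at [(e, false)],
     which contradicts [neqY]. *)
  have := stay #[pi]%g.-1; rewrite prednK ?order_gt0 // expg_order perm1 => eq_Y.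
  by rewrite eq_Y eqxx in neqY.
split=> // d; have [de|/Yd//] := eqVneq d.1 e.
by case: d de => _ [] /= ->; rewrite Ye eY.
Qed.

Lemma invariant_merges pi r Y : perm_invariant (foldl merge pi r) Y <->
  perm_invariant pi Y /\ forall e, e \in r -> ((e, true) \in Y) = ((e, false) \in Y).
Proof.
elim: r pi => [|e r IH] pi /=; first by split=> [|[]].
rewrite IH invariant_merge; split=> [[[Ypi eY] rY]|[Ypi rY]]; split=> //.
- by move=> e'; rewrite inE => /predU1P[->|/rY].
- by split=> //; apply: rY; rewrite mem_head.
- by move=> e' e'r; apply: rY; rewrite inE e'r orbT.
Qed.

(* There is no directed cut with respect to [o] in the graph whose vertices   *)
(* are the orbits of [pi], with the edges of [A] contracted.                  *)
Definition cut_free pi A o := forall Y, perm_invariant pi Y ->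
  (forall e, e \in A -> ((e, true) \in Y) = ((e, false) \in Y)) ->
  (forall d, d \in o -> d \in Y -> drev d \in Y) ->
  forall d, d \in o -> (d \in Y) = (drev d \in Y).

(** The rotation of the dual is the inverse of the face permutation, but cuts depend only on the
    orbits. *)
Lemma cut_freeV pi A o : cut_free pi^-1 A o <-> cut_free pi A o.
Proof. by split=> H Y Ypi; apply: H; apply/invariantV. Qed.

Lemma cut_free_merges pi A o :
  cut_free (foldl merge pi (enum A)) set0 o <-> cut_free pi A o.
Proof.
split=> H Y Ypi YA.
  apply: H => [|e]; last by rewrite inE.
  by apply/invariant_merges; split=> // e; rewrite mem_enum; apply: YA.
have [{}Ypi {}YA] := (invariant_merges _ _ _).1 Ypi.
by apply: H => // e eA; apply: YA; rewrite mem_enum.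
Qed.

Definition orbits_of pi Y := [set porbit pi d | d in Y].

Lemma mem_orbits_of pi Y d : perm_invariant pi Y ->
  (porbit pi d \in orbits_of pi Y) = (d \in Y).
Proof.
move=> Ypi; apply/imsetP/idP => [[d' d'Y /(invariant_porbit Ypi)->//]|dY].
by exists d.
Qed.

Lemma invariant_orbits pi (X : {set {set dart E}}) :
  perm_invariant pi [set d | porbit pi d \in X].
Proof. by move=> d; rewrite !inE porbit_perm1. Qed.

Lemma no_cut_free pi o : no_cut (porbit pi) o <-> cut_free pi set0 o.
Proof.
split=> H.
  move=> Y Ypi _ Yo d dO; rewrite -!(mem_orbits_of _ Ypi); apply: H => // d' d'O.
  by rewrite !mem_orbits_of //; apply: Yo.
move=> X Xo d dO; have := H _ (invariant_orbits pi X) _ _ d dO; rewrite !inE; apply.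
  by move=> e; rewrite inE.
by move=> d' d'O; rewrite !inE; apply: Xo.
Qed.

Lemma pointed_cut_free pi S Z s : Z \subset S ->
  pointed (int_cut (porbit pi) S) Z set0 s <-> cut_free pi (S :\: Z) (orient Z s).
Proof.
move=> ZS; rewrite pointed_cutP //; split=> H.
  move=> Y Ypi SY Yo d; rewrite inE => /andP[dZ _].
  have {}H : ((d.1, true) \in Y) = ((d.1, false) \in Y).
    rewrite -!(mem_orbits_of _ Ypi); apply: H => // [e eS|d' d'o].
      by rewrite !mem_orbits_of //; apply: SY.
    by rewrite !mem_orbits_of //; apply: Yo.
  by case: d H {dZ} => e [].
move=> X SX Xo e eZ; have := H _ (invariant_orbits pi X) _ _ _ (mem_orient s eZ).
rewrite !inE /drev /= => {}H.
have : (porbit pi (e, e \in s) \in X) = (porbit pi (e, e \notin s) \in X).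
  by apply: H => [e' /SX|d /Xo]; rewrite !inE.
by case: (e \in s).
Qed.

(** A dart crosses from the face on its right to the face on its left. So a boundary with all signs
    1 means that every dart of [o] crossing it enters the set of faces, which is a directed cut
    among the faces. *)
Lemma BAO_cut_free G o : orientation G o ->
  (o \in BAO G) = `[< cut_free (face_perm G) set0 o >].
Proof.
move=> oG; rewrite inE oG /=; apply: asbool_equiv_eq; split=> [nobd Y Ypi _ Yo d dO|cf].
  apply/eqP/negP => /negP neqY; apply: nobd; exists (orbits_of (face_perm G) Y).
  have bdE e : (e \in boundary G (orbits_of (face_perm G) Y)) =
      (e \in edges G) && (((e, true) \in Y) (+) ((e, false) \in Y)).
    by rewrite inE /face !mem_orbits_of.
  split; first by apply/subsetP=> _ /imsetP[d' _ ->]; apply: imset_f.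
  split.
    apply/set0Pn; exists d.1; rewrite bdE (orientation_edges oG dO).
    by case: d neqY {dO} => e []; rewrite /drev /=; do 2!case: (_ \in Y).
  exists 1%R; split; first by left.
  move=> d' d'O d'b; rewrite /boundary_sign d'b /face mem_orbits_of //=.
  move: d'b; rewrite bdE => /andP[_]; have := Yo _ d'O.
  by case: d' {d'O} => e []; rewrite /drev /=; do 2!case: (_ \in Y) => //; move/(_ isT).
move=> [F' [_ [/set0Pn[e eF] [sgn [sgn1 sgnP]]]]].
(* For the sign -1 the complement is taken, so that darts of [o] enter [Y] in both cases. *)
pose Y := [set d | (face G d \in F') (+) (sgn != 1%R)].
have Ypi : perm_invariant (face_perm G) Y by move=> d; rewrite !inE /face porbit_perm1.
have bdE d : (d.1 \in boundary G F') = (d.1 \in edges G) && ((d \in Y) != (drev d \in Y)).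
  rewrite !inE; case: d => e' []; rewrite /drev /=;
    by do 2!case: (face G _ \in F'); case: (sgn != 1%R).
have Yo d : d \in o -> d \in Y -> drev d \in Y.
  move=> dO dY; apply: contraT => dY'.
  have dF : d.1 \in boundary G F' by rewrite bdE (orientation_edges oG dO) dY (negPf dY').
  have := sgnP d dO dF; rewrite /boundary_sign dF /=.
  move: dY dY'; rewrite !inE; case: sgn1 => -> /=; by case: (face G (drev d) \in F').
have eG : e \in edges G by move: eF; rewrite inE => /andP[].
have [d dO de] := orientation_dart oG eG.
have := cf Y Ypi _ Yo d dO; move: eF; rewrite -de bdE => /andP[_ /eqP neqY] eqY.
by apply: neqY; apply: eqY => e'; rewrite inE.
Qed.

(** * Effect of the minor operations on vertices and faces *)

Lemma edges_abstract_contract G A : edges (abstract_contract G A) = edges G :\: A.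
Proof.
suff H r : edges (foldl (@abstract_contract1 E) G r) = edges G :\: [set:: r].
  by rewrite /abstract_contract H; congr (_ :\: _); apply/setP=> e; rewrite inE mem_enum.
elim: r G => [|e r IH] G /=; first by rewrite set_nil setD0.
by rewrite IH set_cons -setDDl; congr (_ :\: _); rewrite /abstract_contract1; case: ifP.
Qed.

Lemma rot_abstract_contract G A :
  Defs.rot (abstract_contract G A) = foldl merge (Defs.rot G) (enum A).
Proof.
rewrite /abstract_contract; elim: (enum A) G => //= e r IH G; rewrite IH.
by rewrite /abstract_contract1 /merge /is_loop /vert; case: ifP.
Qed.

Lemma edges_codelete G A : edges (codelete G A) = edges G :\: A.
Proof.
suff H r : edges (foldl (@codelete1 E) G r) = edges G :\: [set:: r].
  by rewrite /codelete H; congr (_ :\: _); apply/setP=> e; rewrite inE mem_enum.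
elim: r G => [|e r IH] G /=; first by rewrite set_nil setD0.
by rewrite IH set_cons -setDDl; congr (_ :\: _); rewrite /codelete1; case: ifP.
Qed.

Lemma flipD1 A e : e \in A -> flip A = (flip (A :\ e) * flip [set e])%g.
Proof.
move=> eA; apply/permP=> d; rewrite permM !flipE !inE.
by have [->|] := eqVneq d.1 e; rewrite /= ?eA ?eqxx // => /negPf de; case: ifP; rewrite /= ?de.
Qed.

(** Ribbon contraction keeps the boundary components: the flip of [e] moves from the edges into the
    rotation. *)
Lemma face_perm_contract1 G e : e \in edges G -> face_perm (contract1 G e) = face_perm G.
Proof. by move=> eG; rewrite /face_perm /= mulgA -flipD1. Qed.

Lemma face_perm_delete1 G e : e \in edges G ->
  face_perm (delete1 G e) = (flip [set e] * face_perm G)%g.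
Proof.
move=> eG; rewrite /face_perm /= mulgA; congr (_ * _)%g.
rewrite -[RHS]invgK invMg !flipV (flipD1 eG) -mulgA flipK mulg1.
by rewrite flipV.
Qed.

Lemma foldl_edges (op : sgraph E -> E -> sgraph E) (f : sgraph E -> {perm dart E})
    (g : {perm dart E} -> E -> {perm dart E}) G A :
  (forall G e, edges (op G e) = edges G :\ e) ->
  (forall G e, e \in edges G -> f (op G e) = g (f G) e) ->
  A \subset edges G -> f (foldl op G (enum A)) = foldl g (f G) (enum A).
Proof.
move=> op_edges f_op AG.
have : all (fun e => e \in edges G) (enum A).
  by apply/allP=> e; rewrite mem_enum; apply: subsetP.
elim: (enum A) (enum_uniq A) G {AG} => //= e r IH /andP[er ur] G /andP[eG rG].
rewrite IH ?f_op //; apply/allP=> e' e'r; rewrite op_edges !inE (allP rG) // andbT.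
by apply: contraNneq er => <-.
Qed.

(** Contracting a coloop does not change the faces, and deleting an edge between two distinct faces
    merges them. *)
Lemma face_perm_codelete G A : A \subset edges G ->
  face_perm (codelete G A) = foldl merge (face_perm G) (enum A).
Proof.
apply: foldl_edges => [H e|H e eH]; rewrite /codelete1; case: ifP => //.
  by rewrite face_perm_contract1 // /merge /is_coloop /face => ->.
by rewrite face_perm_delete1 // /merge /is_coloop /face => ->.
Qed.

Lemma edges_contract G A : edges (contract G A) = edges G :\: A.
Proof.
suff H r : edges (foldl (@contract1 E) G r) = edges G :\: [set:: r].
  by rewrite /contract H; congr (_ :\: _); apply/setP=> e; rewrite inE mem_enum.
elim: r G => [|e r IH] G /=; first by rewrite set_nil setD0.
by rewrite IH set_cons -setDDl.
Qed.

Lemma face_perm_contract G A : A \subset edges G -> face_perm (contract G A) = face_perm G.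
Proof.
move=> AG; rewrite (@foldl_edges (@contract1 E) (@face_perm E) (fun pi _ => pi)) //.
  by elim: (enum A).
by move=> H e; apply: face_perm_contract1.
Qed.

Lemma dual_contract G A : A \subset edges G -> dual (contract G A) = delete (dual G) A.
Proof.
move=> AG; rewrite /dual edges_contract face_perm_contract //.
have := edges_delete (dual G) A; have := rot_delete (dual G) A.
by case: (delete _ _) => S r /= -> ->.
Qed.

Lemma orientation_edgesE G H o : edges G = edges H -> orientation G o = orientation H o.
Proof. by move=> eqE; rewrite /orientation eqE. Qed.

(** Codeletion merges the faces as abstract contraction merges the vertices of the dual, and both
    orientation classes say that no directed cut remains. *)
Lemma BAO_codelete G A : A \subset edges G ->
  BAO (codelete G A) = TCO (abstract_contract (dual G) A).
Proof.
move=> AG; have eqE : edges (codelete G A) = edges (abstract_contract (dual G) A).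
  by rewrite edges_codelete edges_abstract_contract.
apply/setP=> o; have [oG|oG] := boolP (orientation (codelete G A) o); last first.
  by rewrite !inE -(orientation_edgesE _ eqE) (negPf oG).
rewrite BAO_cut_free // TCO_no_cut -?(orientation_edgesE _ eqE) //.
apply: asbool_equiv_eq; rewrite no_cut_free rot_abstract_contract face_perm_codelete //.
by rewrite !cut_free_merges cut_freeV.
Qed.

Lemma codelete0 G : codelete G set0 = G.
Proof. by rewrite /codelete enum_set0. Qed.

Lemma abstract_contract0 G : abstract_contract G set0 = G.
Proof. by rewrite /abstract_contract enum_set0. Qed.

Lemma BAO_dual G : BAO G = TCO (dual G).
Proof. by have := BAO_codelete (sub0set (edges G)); rewrite codelete0 abstract_contract0. Qed.

Lemma card_TCO_abstract_contract G A : A \subset edges G ->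
  (#|TCO (abstract_contract G A)|%:Z =
   \sum_(B : {set E} | B \subset edges G :\: A)
     (-1) ^+ tension_dim (vert G) (edges G) (edges G :\: B))%R.
Proof.
move=> AG; rewrite -card_pointed_cut ?subsetDl //; congr Posz.
have -> : TCO (abstract_contract G A) = [set o | orientation (abstract_contract G A) o &
    `[< cut_free (Defs.rot G) A o >]].
  apply/setP=> o; have [oG|oG] := boolP (orientation (abstract_contract G A) o); last first.
    by rewrite !inE (negPf oG).
  rewrite TCO_no_cut // inE oG; apply: asbool_equiv_eq.
  by rewrite no_cut_free rot_abstract_contract cut_free_merges.
rewrite card_orientations edges_abstract_contract; apply: eq_card => s; rewrite !inE.
congr (_ && _); apply: asbool_equiv_eq.
by rewrite pointed_cut_free ?subsetDl // setDDr setDv set0U (setIidPr AG).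
Qed.

(** Flows and tensions exchange their roles in [tau_reciprocity]; the global sign is now the parity
    of [flow_dim] of the whole graph. *)
Lemma phi_reciprocity G k : 0 < k ->
  abs_value_at (phi G) (- k%:Z)
    #|[set p : {ffun E -> Zmod k} * {set dart E} |
        (p.1 \in flows (Zmod k) G) & (p.2 \in TCO (abstract_contract G (supp p.1)))]|.
Proof.
move=> k_gt0; rewrite (card_dep_pairs _ (fun x o => o \in TCO (abstract_contract G (supp x)))).
have -> : \sum_(x in flows (Zmod k) G) #|[set o in TCO (abstract_contract G (supp x))]| =
    \sum_(x in flows (Zmod k) G)
      #|TCO (abstract_contract G (edges G :\: (edges G :\: supp x)))|.
  apply: eq_bigr => x; rewrite inE => /andP[xG _]; rewrite setDDr setDv set0U.
  by rewrite (setIidPr xG) cardsE.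
apply: (@reciprocity E (edges G) (fun k => flows (Zmod k) G)
    (fun B => flow_dim (vert G) (edges G :\: B))
    (fun B => tension_dim (vert G) (edges G) (edges G :\: B))
    (fun Z => #|TCO (abstract_contract G (edges G :\: Z))|)
    (odd (flow_dim (vert G) (edges G)))) => //.
- by move=> j _ x; rewrite inE => /andP[].
- move=> j j_gt0 B BG; transitivity #|flow_set (vert G) (Zmod j) (edges G :\: B)|.
    apply: eq_card => x; rewrite inE flowsE !inE subsetD disjoint_sym.
    by rewrite -!andbA; congr (_ && _); rewrite andbC.
  by rewrite card_flow_set card_ord prednK.
- move=> Z ZG; rewrite card_TCO_abstract_contract ?subsetDl //.
  by rewrite setDDr setDv set0U (setIidPr ZG).
- move=> B BG; have := tension_flow_dim (vert G) (subsetDl (edges G) B).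
  have := cardsD (edges G) B; rewrite (setIidPr BG); have := subset_leq_card BG; lia.
Qed.

End Cuts.

(** * Duality *)

Lemma uniq_map_inj_in (T T' : eqType) (f : T -> T') (r : seq T) :
  uniq (map f r) -> {in r &, injective f}.
Proof.
elim: r => //= x r IH /andP[fx_r r_uniq] y z; rewrite !inE.
move=> /predU1P[->|yr] /predU1P[->|zr] // fE.
- by rewrite fE map_f in fx_r.
- by rewrite -fE map_f in fx_r.
- exact: IH.
Qed.

Section Cycles.

Variables (E V : finType) (at_ : dart E -> V).
Implicit Types (c : seq (dart E)).

Lemma simple_cycle_drev c :
  simple_cycle (at_ \o @drev E) c = simple_cycle at_ [seq drev d | d <- c].
Proof.
rewrite /simple_cycle cycle_map -!map_comp; congr [&& _, _, _ & _].
by case: c.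
Qed.

Lemma cycle_starts c : path.cycle (fun d d' => at_ (drev d) == at_ d') c ->
  perm_eq [seq at_ d | d <- c] [seq at_ (drev d) | d <- c].
Proof.
case: c => // d c /cycle_walk/walk_starts starts.
by rewrite -(perm_cons (at_ d)) -starts perm_sym perm_rcons.
Qed.

Lemma simple_cycle_rev c :
  simple_cycle at_ (rev [seq drev d | d <- c]) = simple_cycle at_ c.
Proof.
suff imp c' : simple_cycle at_ c' -> simple_cycle at_ (rev [seq drev d | d <- c']).
  apply/idP/idP => [/imp|/imp//].
  by rewrite map_rev revK -map_comp (eq_map (@drevK E)) map_id.
move=> /and4P[c0 cyc_c uniq_at uniq_e]; rewrite /simple_cycle rev_cycle cycle_map.
rewrite !map_rev !rev_uniq -!map_comp uniq_e.
have -> : uniq [seq (at_ \o @drev E) d | d <- c'].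
  by rewrite -(perm_uniq (cycle_starts cyc_c)).
rewrite !andbT -size_eq0 size_rev size_map size_eq0 c0 /=.
by move: cyc_c; congr is_true; apply: eq_cycle => d d' /=; rewrite drevK eq_sym.
Qed.

End Cycles.

Lemma eq_simple_cycle (E V V' : finType) (at_ : dart E -> V) (at' : dart E -> V')
    (c : seq (dart E)) (S : {set E}) :
  (forall d d', d.1 \in S -> d'.1 \in S -> (at_ d == at_ d') = (at' d == at' d')) ->
  all (fun d => d.1 \in S) c -> simple_cycle at_ c = simple_cycle at' c.
Proof.
move=> eq_at /allP cS; rewrite /simple_cycle; congr [&& _, _, _ & _].
  by apply: (@eq_in_cycle _ (mem c)) => [d d' /cS dS /cS d'S|]; [apply: eq_at|apply/allP].
elim: c cS => //= d c IH cS; rewrite IH => [|d' d'c]; last by rewrite cS // inE d'c orbT.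
congr (~~ _ && _); apply/mapP/mapP => -[d' d'c /eqP dd']; exists d' => //; apply/eqP.
  by rewrite -eq_at ?cS ?mem_head // inE d'c orbT.
by rewrite eq_at ?cS ?mem_head // inE d'c orbT.
Qed.

(* The divergence at an orbit of [pi] telescopes. *)
Lemma coboundary_flow (E : finType) (M : zmodType) (S : {set E})
    (pi : {perm dart E}) (q : dart E -> M) (x : E -> M) :
  (forall e, e \in S -> x e = q (e, false) - q (e, true))%R ->
  (forall e, e \notin S -> x e = 0)%R ->
  (forall d, q (pi d) = q (flip S d)) -> is_flow (porbit pi) x.
Proof.
move=> xS x0 q_pi v; apply/eqP; rewrite -subr_eq0; apply/eqP.
have val e : (x e = q (e, false) - q (flip S (e, false)))%R /\
             (- x e = q (e, true) - q (flip S (e, true)))%R.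
  by rewrite !flipE /=; case: ifP => eS; [rewrite xS // opprB|rewrite x0 ?eS // !subrr oppr0].
have -> : (inflow (porbit pi) x v - outflow (porbit pi) x v =
    \sum_(d | porbit pi d == v) (q d - q (flip S d)))%R.
  transitivity (\sum_e \sum_(b | porbit pi (e, b) == v) (q (e, b) - q (flip S (e, b))))%R.
    rewrite /inflow /outflow -sumrN big_mkcond [X in (_ + X)%R]big_mkcond -big_split /=.
    apply: eq_bigr => e _; rewrite [RHS]big_mkcond /= big_bool /= addrC.
    by have [<- <-] := val e.
  by rewrite pair_big_dep /=; apply: eq_big => -[e b].
rewrite sumrB; apply/eqP; rewrite subr_eq0; apply/eqP.
(* An orbit is mapped to itself by [pi], and [q (pi d)] equals [q (flip S d)], so the two sums
   agree. *)
rewrite (reindex_inj (@perm_inj _ pi)) /=.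
by apply: eq_big => d; [rewrite porbit_perm1|rewrite q_pi].
Qed.

Lemma walk_mem_closed (E V : finType) (at_ : dart E -> V) (D : {set dart E})
    (X : {set V}) u w v : out_closed at_ D X -> {subset w <= D} ->
  walk at_ u w v -> u \in X -> forall d, d \in w -> at_ d \in X.
Proof.
move=> DX; elim: w u => //= d w IH u wD /andP[/eqP <- ww] dX d'.
rewrite inE => /predU1P[->//|d'w]; apply: IH ww _ d' d'w.
  by move=> d1 d1w; rewrite wD // inE d1w orbT.
by apply: DX; rewrite ?wD ?mem_head.
Qed.

Section Duality.

Variable E : finType.
Implicit Types (G H : sgraph E) (A B : {set E}) (o : {set dart E}).

Lemma vert_dual G : vert (dual G) = face G.
Proof. by apply: funext => d; rewrite /vert /face /= porbitV. Qed.

Lemma face_perm_flip G d : face_perm G (flip (edges G) d) = Defs.rot G d.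
Proof. by rewrite permM -[flip _ (flip _ _)]permM flipK perm1. Qed.

Lemma rot_flip G d : Defs.rot G (flip (edges G) d) = face_perm G d.
Proof. by rewrite permM. Qed.

(** The double dual is not [G] on the nose: its rotation is that of [G] conjugated by the flip, so
    all darts are reversed. *)
Lemma vert_dual_dual G d d' : d.1 \in edges G -> d'.1 \in edges G ->
  (vert (dual (dual G)) d == vert (dual (dual G)) d') =
  (vert G (drev d) == vert G (drev d')).
Proof.
move=> dG d'G; rewrite vert_dual /face /vert !eq_porbit_mem.
have -> : face_perm (dual G) = ((Defs.rot G)^-1 ^ flip (edges G))%g.
  by rewrite /face_perm /= invMg conjgE flipV mulgA.
have flip_rev d1 : d1.1 \in edges G -> flip (edges G) (drev d1) = d1.
  by move=> d1G; rewrite flipE d1G drevK.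
have step i d1 : (((Defs.rot G)^-1 ^ flip (edges G)) ^+ i)%g (flip (edges G) d1) =
    flip (edges G) (((Defs.rot G)^-1 ^+ i)%g d1).
  by rewrite -conjXg permJ.
rewrite -[X in X \in _]flip_rev // -[X in porbit _ X]flip_rev //.
rewrite -[in RHS]porbitV.
apply/porbitP/porbitP => -[i di]; exists i; last by rewrite step -di.
by move: di; rewrite step => /perm_inj.
Qed.

(** The sum along the boundary of a face is the divergence there: an edge with this face on both
    sides is no boundary edge, and its inflow and outflow cancel. *)
Lemma local_tensionsE (M : finZmodType) G :
  local_tensions M G = flow_set (face G) M (edges G).
Proof.
apply/setP=> x; rewrite !inE; case xG: (edge_fun G x); move: (xG); rewrite /edge_fun => -> //=.
have div f : (\sum_(e in boundary G [set f]) x e *~ boundary_sign G [set f] (e, true) =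
    inflow (face G) x f - outflow (face G) x f)%R.
  rewrite /inflow /outflow -sumrN big_mkcond [X in (X + _)%R]big_mkcond.
  rewrite [X in (_ + X)%R]big_mkcond -big_split /=; apply: eq_bigr => e _.
  rewrite /boundary_sign inE !in_set1 /drev /=.
  have [eG|eG] := boolP (e \in edges G); last first.
    by move/supp_subP: xG => ->//; rewrite oppr0 !if_same addr0.
  by case: (_ == f); case: (_ == f); rewrite //= ?mulr1z ?mulrN1z ?addr0 ?add0r ?subrr.
apply/forall_inP/forallP => [H f|H f _]; last by rewrite div subr_eq0; apply: H.
have [/H|fG] := boolP (f \in faces G); first by rewrite div subr_eq0.
rewrite /inflow /outflow !big_pred0 // => e; apply: contraNF fG => /eqP <-; exact: imset_f.
Qed.

Lemma local_tensions_dual (M : finZmodType) G : local_tensions M G = flows M (dual G).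
Proof. by rewrite local_tensionsE flowsE vert_dual. Qed.

(** Cocycles are the cycles of the dual, so balance is the tension condition. The flow condition
    then follows from [coboundary_flow], applied to the potential on the faces. *)
Lemma balanced_flows_dual (M : finZmodType) G : balanced_flows M G = tensions M (dual G).
Proof.
apply/setP=> x; have cyc_dual : cocycle G =1 directed_cycle (dual G).
  by move=> c; rewrite /directed_cycle vert_dual.
apply/idP/idP => [|xT].
  rewrite !inE => /andP[/andP[xG _] /asboolP xc]; apply/andP; split=> //.
  apply/asboolP => c c_cyc; apply: xc.
  by rewrite cyc_dual.
have /andP[xG /asboolP xc] : edge_fun (dual G) x &&
    `[< forall c, directed_cycle (dual G) c -> (\sum_(d <- c) dart_value x d)%R = 0%R >].
  by rewrite inE in xT.
rewrite inE; apply/andP; split; last by apply/asboolP => c; rewrite cyc_dual; apply: xc.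
rewrite flowsE; apply/flow_setP; split; first by apply/supp_subP.
move: xT; rewrite tensionsE vert_dual => /tension_setP[x0 [p px]].
apply: (coboundary_flow (S := edges G) (q := fun d => p (face G d))) => //.
  by move=> e eG; rewrite x0 // setD0.
by move=> d; rewrite -face_perm_flip /face porbit_perm1.
Qed.

Lemma directed_cycle_dual_dual G c :
  directed_cycle (dual (dual G)) c = directed_cycle G [seq drev d | d <- c].
Proof.
rewrite !directed_cycleE all_map /= -simple_cycle_drev.
have [cG|] := boolP (all (fun d => d.1 \in edges G) c); last by rewrite !andbF.
by rewrite !andbT; apply: eq_simple_cycle cG => d d' dG d'G; rewrite vert_dual_dual.
Qed.

Lemma directed_cycle_rev G c :
  directed_cycle G (rev [seq drev d | d <- c]) = directed_cycle G c.
Proof. by rewrite !directed_cycleE simple_cycle_rev all_rev all_map. Qed.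

Lemma tensions_dual_dual (M : finZmodType) G : tensions M (dual (dual G)) = tensions M G.
Proof.
have opp (x : {ffun E -> M}) c :
    (\sum_(d <- [seq drev d | d <- c]) dart_value x d = - \sum_(d <- c) dart_value x d)%R.
  rewrite big_map -sumrN; apply: eq_bigr => -[e []] _ //.
  by rewrite /dart_value /= opprK.
apply/setP=> x; rewrite !inE; congr (_ && _); apply: asbool_equiv_eq.
split=> H c c_cyc; apply: oppr_inj; rewrite -opp oppr0; apply: H.
  by rewrite directed_cycle_dual_dual -map_comp (eq_map (@drevK E)) map_id.
by rewrite -directed_cycle_dual_dual.
Qed.

(** Reversing all darts exchanges starts and ends, so a directed cycle of the double dual is a
    directed cycle of [G] read backwards, with the same darts. *)
Lemma AO_dual_dual G : AO (dual (dual G)) = AO G.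
Proof.
apply/setP=> o; rewrite !inE; congr (_ && _); apply: asbool_equiv_eq.
have cyc_rev c : directed_cycle (dual (dual G)) (rev c) = directed_cycle G c.
  by rewrite directed_cycle_dual_dual map_rev directed_cycle_rev.
split=> acyc [c [c_cyc co]]; apply: acyc; exists (rev c).
  by rewrite cyc_rev; split=> // d; rewrite mem_rev => /co.
by rewrite -cyc_rev revK; split=> // d; rewrite mem_rev => /co.
Qed.

(** The coboundary of the indicator of [X] is a flow on the faces and conforms to [o] because no
    dart leaves [X]; acyclicity on the dual forces it to be zero. *)
Lemma acyclic_dual_no_cut G o : o \in AO (dual G) -> no_cut (vert G) o.
Proof.
rewrite inE => /andP[oG /asboolP acyc] X Xo d dO.
have oE := orient_orientation oG; set s := [set _ in _ | _] in oE.
have ptd : pointed (int_flow (face G)) (edges G) set0 s.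
  apply/pointed_flowP => -[c c_cyc co]; apply: acyc; exists c; split; last by rewrite -oE.
  by rewrite directed_cycleE vert_dual c_cyc (orient_edges co).
pose q d : int := (vert G d \in X)%:R%R.
pose x e : int := (if e \in edges G then q (e, false) - q (e, true) else 0)%R.
have dG : d.1 \in edges G by apply: orientation_edges dO.
have : x d.1 = 0%R.
  apply: (ptd x) => // [|e|e eG].
  - apply: (coboundary_flow (S := edges G) (q := q)) => [e eG|e eG|d1].
    + by rewrite /x eG.
    + by rewrite /x (negPf eG).
    + by rewrite -rot_flip /q /vert porbit_perm1.
  - by rewrite setU0 /x => /negPf->.
  - have := mem_orient s eG; rewrite [orient _ _]oE => /Xo.
    rewrite /x eG /q /drev /=; case: (e \in s) => /=;
      do 2!case: (_ \in X) => //; by move/(_ isT).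
rewrite /x dG /q; case: (d) => e []; rewrite /drev /=; by do 2!case: (_ \in X).
Qed.

Lemma connect_sym_step (T : finType) (r : rel T) u v :
  (forall u v, r u v -> connect r v u) -> connect r u v -> connect r v u.
Proof.
move=> r_sym /connectP[p + ->]; elim: p u => [|w p IH] u /=; first by rewrite connect0.
by move=> /andP[/r_sym uw /IH wp]; apply: connect_trans uw.
Qed.

(* If [o] is acyclic on the dual side, then it is strongly connected on each  *)
(* component, so that one closed walk can go through a whole component, and   *)
(* all edges of a cocycle lie in the same component.                          *)
Lemma TBO_dual G : TBO G = AO (dual G).
Proof.
have cyc_dual c : cocycle G c = directed_cycle (dual G) c.
  by rewrite /directed_cycle vert_dual.
apply/setP=> o; apply/idP/idP => [|oA].
  rewrite !inE => /andP[oG /asboolP oT]; apply/andP; split=> //.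
  apply/asboolP => -[c [c_cyc co]].
  have [d dc] : exists d, d \in c.
    by case: c c_cyc {co} => // d c _; exists d; rewrite mem_head.
  have [w [_ wo w_bi]] := oT d.1 (orientation_edges oG (co d dc)).
  move=> /mapP[d' d'w dd'].
  have [||d1 [d2 [d1w d2w d1c d2c]]] := w_bi c; first by rewrite cyc_dual.
    by exists d' => //; rewrite -dd' map_f.
  (* Both [w] and [c] lie in [o], which contains a single dart of each edge; so [w] traverses edges
     of [c] only in the direction of [c], and all pairs are coherent. *)
  have in_c d3 : d3 \in w -> d3.1 \in [seq d.1 | d <- c] -> d3 \in c.
    move=> /wo d3o /mapP[d4 d4c d34]; have [->//|d3E] := same_edge d34.
    by have := orientation_anti oG (co _ d4c); rewrite -d3E d3o.
  by rewrite /coherent_pair !in_c.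
have o_cut := acyclic_dual_no_cut oA.
move: oA; rewrite !inE => /andP[oG /asboolP acyc]; rewrite [orientation _ _]oG /=.
have anti d : d \in o -> drev d \notin o by apply: (orientation_anti oG).
have o_cyc := (cycles_no_cut (vert G) anti).2 o_cut.
have o_sym u v : connect (step (vert G) o) u v -> connect (step (vert G) o) v u.
  apply: connect_sym_step => {u v} u v /exists_inP[d dO /andP[/eqP <- /eqP <-]].
  have [c c_cyc [co dc]] := o_cyc d dO.
  have [w [/andP[_ ww] _ wc]] := simple_cycle_rot c_cyc dc.
  by apply: walk_connect ww => d' d'w; apply: co; rewrite -wc inE d'w orbT.
apply/asboolP => e eG; have [d0 d0o d0e] := orientation_dart oG eG.
pose v0 := vert G d0; pose K := [set v | connect (step (vert G) o) v0 v].
have Ko : out_closed (vert G) o K.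
  move=> d dO; rewrite !inE => /connect_trans; apply; apply: connect1.
  by apply/exists_inP; exists d; rewrite ?eqxx.
(* Each dart is inserted by a detour: strong connectivity gives a walk from [v0] to the dart and a
   walk back. *)
have tour (r : seq (dart E)) : {subset r <= [set d in o | vert G d \in K]} ->
    exists w, [/\ walk (vert G) v0 w v0, {subset w <= o} & {subset r <= w}].
  elim: r => [|d r IH] rK; first by exists [::]; split=> //=; rewrite eqxx.
  have [|w [ww wo rw]] := IH; first by move=> d1 d1r; apply: rK; rewrite inE d1r orbT.
  have /setIdP[dO dK] := rK d (mem_head _ _).
  have := Ko d dO dK; have := dK; rewrite !inE => /connect_walk[w1 [ww1 w1o _]].
  move=> /o_sym/connect_walk[w2 [ww2 w2o _]].
  exists (w1 ++ (d :: w2) ++ w); split.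
  - by apply: walk_cat ww1 _; apply: walk_cat ww; rewrite /= eqxx.
  - move=> d1; rewrite !mem_cat inE => /or3P[/w1o//|/predU1P[->//|/w2o//]|/wo//].
  - move=> d1; rewrite !mem_cat !inE => /predU1P[->|/rw->]; first by rewrite eqxx orbT.
    by rewrite !orbT.
have [|w [ww wo Kw]] := tour (enum [set d in o | vert G d \in K]).
  by move=> d; rewrite mem_enum.
have d0w : d0 \in w by apply: Kw; rewrite mem_enum inE d0o inE connect0.
exists w; split=> //; last by rewrite -d0e map_f.
  rewrite /closed_walk; case: (w) ww d0w wo => // d w' ww _ wo.
  apply/and3P; split=> //; last exact: walk_cycle ww.
  by apply/allP=> d' /wo; apply: orientation_edges.
(* The darts at the component [K]. As no edge leaves [K], this set is also a union of faces and is
   stable under reversal, so a cocycle that meets [w] stays inside it. *)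
pose Y := [set d | vert G d \in K].
have Y_rev d : d.1 \in edges G -> (drev d \in Y) = (d \in Y).
  move=> dG; have [d' d'o dd'] := orientation_dart oG dG.
  have := o_cut K Ko d' d'o; rewrite !inE.
  by have [->//|->] := same_edge dd'; rewrite drevK.
have Y_face : perm_invariant (face_perm G) Y.
  move=> d; transitivity (flip (edges G) d \in Y).
    by rewrite -rot_flip !inE /vert porbit_perm1.
  by rewrite flipE; case: ifP => // /Y_rev.
move=> c; rewrite cyc_dual => c_cyc [d dw /mapP[d' d'c dd']].
have cG d1 : d1 \in c -> d1.1 \in edges G.
  by move: c_cyc; rewrite directed_cycleE => /andP[_ /allP]; apply.
have /andP[c_simple _] : simple_cycle (face G) c && true.
  by move: c_cyc; rewrite directed_cycleE vert_dual => /andP[->].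
have cY d1 : d1 \in c -> d1 \in Y.
  have X_closed : out_closed (face G) (darts (edges G)) (orbits_of (face_perm G) Y).
    move=> d2; rewrite inE /face => d2G.
    by rewrite !(mem_orbits_of _ Y_face) Y_rev.
  have [w' [ww' _ wc]] := simple_cycle_rot c_simple d'c.
  rewrite -wc -(mem_orbits_of _ Y_face); apply: walk_mem_closed X_closed _ ww' _ d1.
    by move=> d2; rewrite wc inE => /cG.
  rewrite (mem_orbits_of _ Y_face); have : d \in Y.
    by rewrite inE; apply: walk_mem_closed Ko wo ww _ _ dw; rewrite inE connect0.
  by have [dE|dE] := same_edge dd'; rewrite dE ?Y_rev ?cG.
have c_edges d1 : d1 \in o -> d1.1 \in [seq d.1 | d <- c] -> d1 \in w.
  move=> d1o /mapP[d2 d2c d12]; apply: Kw; rewrite mem_enum inE d1o.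
  have : d1 \in Y by have [->|->] := same_edge d12; rewrite ?Y_rev ?cG ?cY.
  by rewrite inE.
(* If all edges of [c] were directed alike, [c] or its reversal would be a directed cycle of the
   dual. So [c] has an edge along [o] and one against it, and [w] contains both. *)
have [d1 d1c d1o] : exists2 d1, d1 \in c & d1 \in o.
  apply: contrapT => none; apply: acyc; exists (rev [seq drev d | d <- c]); split.
    by rewrite directed_cycle_rev.
  move=> d1; rewrite mem_rev => /mapP[d2 d2c ->]; apply: contraT => d2o.
  by case: none; exists d2; rewrite // (eqP (forallP oG d2)) cG.
have [d2 d2c d2o] : exists2 d2, d2 \in c & drev d2 \in o.
  apply: contrapT => none; apply: acyc; exists c; split=> // d2 d2c.
  rewrite (eqP (forallP oG d2)) cG //=; apply/negP => d2o.
  by apply: none; exists d2.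
exists d1, (drev d2); split.
- by apply: c_edges => //; apply: map_f.
- by apply: c_edges => //; apply: (map_f (fun d => d.1) d2c).
- exact: map_f.
- exact: (map_f (fun d => d.1) d2c).
have /and4P[_ _ _ c_uniq] := c_simple.
rewrite /coherent_pair d1c; apply/negP => /eqP/esym rev_d2c.
have := uniq_map_inj_in c_uniq rev_d2c d2c (erefl _).
by case: (d2) => e' [].
Qed.

Lemma TBO_contract G A : A \subset edges G -> TBO (contract G A) = AO (delete (dual G) A).
Proof. by move=> AG; rewrite TBO_dual dual_contract. Qed.

Lemma tau_dual G k : tau G k = phi_bal (dual G) k.
Proof. by rewrite /tau /phi_bal balanced_flows_dual tensions_dual_dual. Qed.

Lemma phi_bal_tau G : phi_bal G = tau (dual G).
Proof. by apply: funext => k; rewrite /tau /phi_bal balanced_flows_dual. Qed.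

Lemma tau_loc_phi G : tau_loc G = phi (dual G).
Proof. by apply: funext => k; rewrite /tau_loc /phi local_tensions_dual. Qed.

End Duality.

(** For [k = 1] the zero function is the only one and has empty support, so no minor is taken. *)
Lemma card_trivial_pairs (E : finType) (F : {set {ffun E -> Zmod 1}})
    (O : {set E} -> {set {set dart E}}) : (0 : {ffun E -> Zmod 1})%R \in F ->
  #|[set p : {ffun E -> Zmod 1} * {set dart E} | (p.1 \in F) & (p.2 \in O (supp p.1))]| =
  #|O set0|.
Proof.
move=> F0; have x0 (x : {ffun E -> Zmod 1}) : x = 0%R.
  by apply/ffunP => e; rewrite !ord1.
rewrite (card_dep_pairs (fun x => x \in F) (fun x o => o \in O (supp x))).
rewrite (big_pred1 (0 : {ffun E -> Zmod 1})%R) => [|x]; last first.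
  by rewrite (x0 x) F0 /= eqxx.
rewrite cardsE (_ : supp 0%R = set0) //.
by apply/setP=> e; rewrite !inE ffunE eqxx.
Qed.

Theorem theorem4p9 (E : finType) (G : sgraph E) (k : nat) (hk : 0 < k) :
  (* Dualities *)
  [/\ tau G k = phi_bal (dual G) k,
      tau_loc G k = phi (dual G) k,
      #|AO G| = #|TBO (dual G)|
    & #|BAO G| = #|TCO (dual G)| ]
  /\
  (* Evaluations at -1 *)
  [/\ abs_value_at (tau G) (-1) #|AO G|,
      abs_value_at (tau_loc G) (-1) #|BAO G|,
      abs_value_at (phi (dual G)) (-1) #|TCO (dual G)|
    & abs_value_at (phi_bal (dual G)) (-1) #|TBO (dual G)| ]
  /\
  (* Reciprocities *)
  [/\ abs_value_at (tau G) (- k%:Z)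
        #|[set p : {ffun E -> Zmod k} * {set dart E} |
            (p.1 \in tensions (Zmod k) G) &
            (p.2 \in AO (delete G (supp p.1)))]|,
      abs_value_at (tau_loc G) (- k%:Z)
        #|[set p : {ffun E -> Zmod k} * {set dart E} |
            (p.1 \in local_tensions (Zmod k) G) &
            (p.2 \in BAO (codelete G (supp p.1)))]|,
      abs_value_at (phi G) (- k%:Z)
        #|[set p : {ffun E -> Zmod k} * {set dart E} |
            (p.1 \in flows (Zmod k) G) &
            (p.2 \in TCO (abstract_contract G (supp p.1)))]|
    & abs_value_at (phi_bal G) (- k%:Z)
        #|[set p : {ffun E -> Zmod k} * {set dart E} |
            (p.1 \in balanced_flows (Zmod k) G) &
            (p.2 \in TBO (contract G (supp p.1)))]| ].
Proof.
have card_AO_TBO : #|AO G| = #|TBO (dual G)| by rewrite TBO_dual AO_dual_dual.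
have phi_bal_dual : phi_bal (dual G) = tau G by apply: funext => j; rewrite tau_dual.
have tau_at_m1 : abs_value_at (tau G) (-1) #|AO G|.
  have := tau_reciprocity G (ltn0Sn 0).
  rewrite (card_trivial_pairs (fun A => AO (delete G A))) ?/delete ?enum_set0 //.
  rewrite tensionsE; apply/tension_setP; split=> [e _|]; first by rewrite ffunE.
  by exists (fun=> 0%R) => e _; rewrite /diff subrr ffunE.
have phi_at_m1 : abs_value_at (phi (dual G)) (-1) #|TCO (dual G)|.
  have := phi_reciprocity (dual G) (ltn0Sn 0).
  rewrite (card_trivial_pairs (fun A => TCO (abstract_contract (dual G) A))).
    by rewrite abstract_contract0.
  rewrite flowsE; apply/flow_setP; split=> [e _|v]; first by rewrite ffunE.
  by rewrite /inflow /outflow !big1 // => e _; rewrite ffunE.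
split; first by split=> //; rewrite ?BAO_dual ?tau_loc_phi -?tau_dual.
split; first by split=> //; rewrite ?BAO_dual ?tau_loc_phi ?phi_bal_dual -?card_AO_TBO.
split.
- exact: tau_reciprocity.
(* The two remaining reciprocities on faces are those of flows and of tensions on the dual, with the
   minors matched by [BAO_codelete] and [TBO_contract]. *)
- rewrite tau_loc_phi; have := phi_reciprocity (dual G) hk; congr abs_value_at.
  apply: eq_card => p; rewrite [LHS]inE [RHS]inE -local_tensions_dual.
  case xG: (_ \in local_tensions _ _) => //=.
  by rewrite BAO_codelete //; move: xG; rewrite inE => /andP[].
- exact: phi_reciprocity.
rewrite phi_bal_tau; have := tau_reciprocity (dual G) hk; congr abs_value_at.
apply: eq_card => p; rewrite [LHS]inE [RHS]inE -balanced_flows_dual.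
case xG: (_ \in balanced_flows _ _) => //=.
by rewrite TBO_contract //; move: xG; rewrite !inE => /andP[/andP[]].
Qed.
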